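(* Let $\Gamma$ be the middle-third Cantor set, and for $(u,v,w)\in\{0,1\}^3$ let $\mathcal{E}(u,v,w)$ be the set of all $d\in\mathrm{Met}(\Gamma)$ such that $(\Gamma,d)$ is of type $(u,v,w)$. Then: (1) $\mathcal{E}(1,1,1)$ is a dense $F_\sigma$ subset of $(\mathrm{Met}(\Gamma),\mathcal{D}_\Gamma)$; (2) $\mathcal{E}(0,0,0)$ is a dense $G_\delta$ subset of $(\mathrm{Met}(\Gamma),\mathcal{D}_\Gamma)$; (3) for every $(u,v,w)\in\{0,1\}^3$ other than $(1,1,1)$ and $(0,0,0)$, $\mathcal{E}(u,v,w)$ is a dense subset of $(\mathrm{Met}(\Gamma),\mathcal{D}_\Gamma)$ which is both $G_{\delta\sigma}$ and $F_{\sigma\delta}$.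
   Context: $\mathrm{Met}(X)$ is the set of all metrics on a metrizable space $X$ generating its topology, with metric $\mathcal{D}_X(d,e)=\sup_{x,y}|d(x,y)-e(x,y)|$. Let $\mathcal{P}_1,\mathcal{P}_2,\mathcal{P}_3$ denote respectively: doubling (there exist $\beta>0$, $C\ge1$ with $\mathrm{card}(A)\le C(\delta_d(A)/\alpha_d(A))^\beta$ for all finite $A$ with at least two points, where $\delta_d$ is diameter and $\alpha_d(A)=\inf\{d(x,y):x\neq y\in A\}$); uniformly disconnected (there is $\delta\in(0,1)$ with $\delta d(z_1,z_N)\le\max_{1\le i\le N-1}d(z_i,z_{i+1})$ for every non-constant finite sequence $z_1,\dots,z_N$); uniformly perfect (there is $c\in(0,1)$ such that for every $x$ and $r\in(0,\delta_d(X))$ there is $y$ with $cr\le d(x,y)\le r$). A metric space $(X,d)$ is of type $(u_1,u_2,u_3)\in\{0,1\}^3$ if for each $k$, $u_k=1$ exactly when $(X,d)$ satisfies $\mathcal{P}_k$. $F_\sigma$/$G_\delta$: countable union of closed / countable intersection of open sets; $F_{\sigma\delta}$: countable intersection of $F_\sigma$ sets; $G_{\delta\sigma}$: countable union of $G_\delta$ sets. *)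

(* Defs.v *)
From Stdlib Require Import Reals List.
From Coquelicot Require Import Coquelicot.
Open Scope R_scope.

Definition in_cantor (x : R) : Prop :=
  exists a : nat -> bool,
    is_series (fun n => (if a n then 2 else 0) / 3 ^ (S n)) x.

Definition Gamma : Type := { x : R | in_cantor x }.

Definition metricfun := Gamma -> Gamma -> R.

Definition is_metric (d : metricfun) : Prop :=
  (forall x y, 0 <= d x y) /\
  (forall x y, d x y = 0 <-> x = y) /\
  (forall x y, d x y = d y x) /\
  (forall x y z, d x z <= d x y + d y z).

Definition d_open (d : metricfun) (U : Gamma -> Prop) : Prop :=
  forall x, U x -> exists eps, 0 < eps /\ forall y, d x y < eps -> U y.

Definition deucl : metricfun := fun x y => Rabs (proj1_sig x - proj1_sig y).

Definition Met (d : metricfun) : Prop :=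
  is_metric d /\ forall U : Gamma -> Prop, d_open d U <-> d_open deucl U.

Definition DGamma (d e : metricfun) : Rbar :=
  Lub_Rbar (fun t => exists x y, t = Rabs (d x y - e x y)).

Definition met_open (A : metricfun -> Prop) : Prop :=
  forall d, Met d -> A d ->
    exists r, 0 < r /\ forall e, Met e -> Rbar_lt (DGamma d e) r -> A e.

Definition met_closed (A : metricfun -> Prop) : Prop :=
  met_open (fun d => ~ A d).

Definition met_dense (E : metricfun -> Prop) : Prop :=
  forall d, Met d -> forall r, 0 < r ->
    exists e, Met e /\ E e /\ Rbar_lt (DGamma d e) r.

Definition met_Fsigma (E : metricfun -> Prop) : Prop :=
  exists F : nat -> metricfun -> Prop, (forall n, met_closed (F n)) /\
    forall d, Met d -> (E d <-> exists n, F n d).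

Definition met_Gdelta (E : metricfun -> Prop) : Prop :=
  exists G : nat -> metricfun -> Prop, (forall n, met_open (G n)) /\
    forall d, Met d -> (E d <-> forall n, G n d).

Definition met_Fsigmadelta (E : metricfun -> Prop) : Prop :=
  exists F : nat -> metricfun -> Prop, (forall n, met_Fsigma (F n)) /\
    forall d, Met d -> (E d <-> forall n, F n d).

Definition met_Gdeltasigma (E : metricfun -> Prop) : Prop :=
  exists G : nat -> metricfun -> Prop, (forall n, met_Gdelta (G n)) /\
    forall d, Met d -> (E d <-> exists n, G n d).

(** Diameter and minimal separation of a finite set (given as a duplicate-free list). *)
Definition fin_diam (d : metricfun) (A : list Gamma) : R :=
  real (Lub_Rbar (fun t => exists x y, In x A /\ In y A /\ t = d x y)).

Definition fin_sep (d : metricfun) (A : list Gamma) : R :=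
  real (Glb_Rbar (fun t => exists x y, In x A /\ In y A /\ x <> y /\ t = d x y)).

Definition diam_space (d : metricfun) : Rbar :=
  Lub_Rbar (fun t => exists x y, t = d x y).

Definition doubling (d : metricfun) : Prop :=
  exists beta C, 0 < beta /\ 1 <= C /\
    forall A : list Gamma, NoDup A -> (2 <= length A)%nat ->
      INR (length A) <= C * Rpower (fin_diam d A / fin_sep d A) beta.

Definition max_gap (d : metricfun) (z : nat -> Gamma) (N : nat) : R :=
  fold_right Rmax 0 (map (fun i => d (z i) (z (S i))) (seq 0 (N - 1))).

(** P2: uniformly disconnected (sequences z_0, ..., z_{N-1}). *)
Definition unif_disconnected (d : metricfun) : Prop :=
  exists delta, 0 < delta < 1 /\
    forall (N : nat) (z : nat -> Gamma),
      (exists i j, (i < N)%nat /\ (j < N)%nat /\ z i <> z j) ->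
      delta * d (z 0%nat) (z (N - 1)%nat) <= max_gap d z N.

Definition unif_perfect (d : metricfun) : Prop :=
  exists c, 0 < c < 1 /\
    forall (x : Gamma) (r : R), 0 < r -> Rbar_lt r (diam_space d) ->
      exists y, c * r <= d x y <= r.

Definition of_type (d : metricfun) (u1 u2 u3 : bool) : Prop :=
  (u1 = true <-> doubling d) /\
  (u2 = true <-> unif_disconnected d) /\
  (u3 = true <-> unif_perfect d).

Definition Etype (u v w : bool) : metricfun -> Prop :=
  fun d => Met d /\ of_type d u v w.

(* Main.v *)
Require Import Defs.
From Stdlib Require Import Reals Lra Lia Arith List Relations.
From Stdlib Require Import Classical ClassicalEpsilon ProofIrrelevance.
From Stdlib Require Cantor.
From Coquelicot Require Import Coquelicot.
Open Scope R_scope.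

(** Each of the three properties is a union over its constants of closed conditions,
    hence F_sigma; every type is then the intersection of an F_sigma and a G_delta set.

    For density, code the Cantor set by binary sequences. Given a metric [d], choose [n]
    such that [d] is small on all cylinders of depth [n], keep [d] between base points
    of these cylinders, and put a small metric on each cylinder. The result inherits
    a property exactly when all the small metrics have it. Ultrametrics depending on the
    first difference [k] provide most models: [3 ^ -k] has all three properties,
    [1 / (k + 1)] is not doubling, [3 ^ -(k * k)] is not uniformly perfect. A Cantor
    subset of the line whose gaps are thin relative to their scale is not uniformly
    disconnected. *)

(** Each model spoils at most one of the three properties and keeps the other two. All eight types
    therefore arise by placing the required defects on separate cylinders. A defect shows at
    arbitrarily small scales, hence inside a single cylinder, and is not repaired by what happens
    elsewhere. Conversely, only finitely many cylinders, at positive mutual distances, are put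
    together, so constants for the models yield constants for the whole space.

    The obstacle to closedness is that a defining condition with a premise on [d] or an existential
    witness need not pass to limits. The closed conditions therefore carry explicit room, or a free
    bound in place of a maximum, and the constants absorb the change. In a metric space open sets
    are F_sigma and closed sets are G_delta, so the intersection of an F_sigma and a G_delta set
    lies in both classes of the third claim. *)

Lemma DGamma_lt_iff (d e : metricfun) (r : R) :
  Rbar_lt (DGamma d e) r <->
  exists s, s < r /\ forall x y, Rabs (d x y - e x y) <= s.
Proof.
  unfold DGamma.
  destruct (Lub_Rbar_correct (fun t => exists x y, t = Rabs (d x y - e x y)))
    as [Hub Hlub].
  set (L := Lub_Rbar _) in *.
  split.
  - intros H. destruct L as [s| |] eqn:EL.
    + exists s. split; [exact H|].
      intros x y. apply (Hub (Rabs (d x y - e x y))). now exists x, y.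
    + contradiction.
    + exists (r - 1). split; [lra|]. intros x y.
      exfalso. apply (Hub (Rabs (d x y - e x y))). now exists x, y.
  - intros [s [Hs H]].
    apply Rbar_le_lt_trans with (Finite s); [|exact Hs].
    apply Hlub. intros t [x [y ->]]. apply H.
Qed.

Lemma DGamma_lt_close (d e : metricfun) (r : R) :
  Rbar_lt (DGamma d e) r -> forall x y, d x y - r < e x y < d x y + r.
Proof.
  intros H x y. apply DGamma_lt_iff in H. destruct H as [s [Hs H]].
  specialize (H x y). apply Rabs_le_between in H. lra.
Qed.

Lemma diam_space_gt_iff (d : metricfun) (r : R) :
  Rbar_lt r (diam_space d) <-> exists a b, r < d a b.
Proof.
  unfold diam_space.
  destruct (Lub_Rbar_correct (fun t => exists x y, t = d x y)) as [Hub Hlub].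
  set (L := Lub_Rbar _) in *.
  split.
  - intros H. apply NNPP; intros Hn.
    assert (HL : Rbar_le L r).
    { apply Hlub. intros t [x [y ->]]. simpl.
      apply Rnot_lt_le. intros Hr. apply Hn. now exists x, y. }
    apply (Rbar_lt_not_le _ _ H HL).
  - intros [a [b H]]. apply Rbar_lt_le_trans with (Finite (d a b)); [exact H|].
    apply Hub. now exists a, b.
Qed.

(** * Borel classes in the space of metrics *)

Lemma met_Fsigma_and (A B : metricfun -> Prop) :
  met_Fsigma A -> met_Fsigma B -> met_Fsigma (fun d => A d /\ B d).
Proof.
  intros [F [HF HA]] [G [HG HB]].
  exists (fun n d => F (fst (Cantor.of_nat n)) d /\ G (snd (Cantor.of_nat n)) d).
  split.
  - intros n d Hd Hn. apply not_and_or in Hn. destruct Hn as [Hn|Hn].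
    + destruct (HF _ d Hd Hn) as [r [Hr H]]. exists r. split; [exact Hr|].
      intros e He Hde [H1 _]. now apply (H e He Hde).
    + destruct (HG _ d Hd Hn) as [r [Hr H]]. exists r. split; [exact Hr|].
      intros e He Hde [_ H1]. now apply (H e He Hde).
  - intros d Hd. rewrite (HA d Hd), (HB d Hd). split.
    + intros [[n Hn] [m Hm]]. exists (Cantor.to_nat (n, m)).
      rewrite Cantor.cancel_of_to. now split.
    + intros [n [H1 H2]]. split; eexists; eassumption.
Qed.

Lemma met_Gdelta_and (A B : metricfun -> Prop) :
  met_Gdelta A -> met_Gdelta B -> met_Gdelta (fun d => A d /\ B d).
Proof.
  intros [F [HF HA]] [G [HG HB]].
  exists (fun n d => F n d /\ G n d). split.
  - intros n d Hd [H1 H2].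
    destruct (HF n d Hd H1) as [r [Hr H]]. destruct (HG n d Hd H2) as [s [Hs H']].
    exists (Rmin r s). split; [now apply Rmin_pos|]. intros e He Hde. split.
    + apply H; [exact He|]. eapply Rbar_lt_le_trans; [exact Hde|]. apply Rmin_l.
    + apply H'; [exact He|]. eapply Rbar_lt_le_trans; [exact Hde|]. apply Rmin_r.
  - intros d Hd. rewrite (HA d Hd), (HB d Hd). split.
    + intros [H1 H2] n. now split.
    + intros H. split; intros n; apply H.
Qed.

Lemma met_Fsigma_ext (A B : metricfun -> Prop) :
  (forall d, Met d -> (B d <-> A d)) -> met_Fsigma A -> met_Fsigma B.
Proof.
  intros HAB [F [HF HA]]. exists F. split; [exact HF|].
  intros d Hd. now rewrite (HAB d Hd), (HA d Hd).
Qed.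

Lemma met_Gdelta_ext (A B : metricfun -> Prop) :
  (forall d, Met d -> (B d <-> A d)) -> met_Gdelta A -> met_Gdelta B.
Proof.
  intros HAB [F [HF HA]]. exists F. split; [exact HF|].
  intros d Hd. now rewrite (HAB d Hd), (HA d Hd).
Qed.

Lemma met_Gdelta_not (A : metricfun -> Prop) :
  met_Fsigma A -> met_Gdelta (fun d => ~ A d).
Proof.
  intros [F [HF HA]]. exists (fun n d => ~ F n d). split; [exact HF|].
  intros d Hd. rewrite (HA d Hd). split.
  - intros H n Hn. apply H. now exists n.
  - intros H [n Hn]. now apply (H n).
Qed.

(** The pieces consist of the metrics whose ball of radius [/ (INR n + 1)] stays in [U]. Such a set
    is closed: if a ball contains a bad [e] at distance at most [s], so does the ball of every
    metric within the remaining [/ (INR n + 1) - s]. *)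
Lemma met_open_Fsigma (U : metricfun -> Prop) : met_open U -> met_Fsigma U.
Proof.
  intros HU.
  exists (fun n d => forall e, Met e -> Rbar_lt (DGamma d e) (/ (INR n + 1)) -> U e).
  split.
  - intros n d Hd Hn. apply not_all_ex_not in Hn. destruct Hn as [e He].
    apply imply_to_and in He. destruct He as [He Hn].
    apply imply_to_and in Hn. destruct Hn as [Hde Hn].
    apply DGamma_lt_iff in Hde. destruct Hde as [s [Hs H]].
    exists (/ (INR n + 1) - s). split; [lra|].
    intros d' Hd' Hdd' Hall. apply Hn, Hall; [exact He|].
    apply DGamma_lt_iff in Hdd'. destruct Hdd' as [s' [Hs' H']].
    apply DGamma_lt_iff. exists (s + s'). split; [lra|]. intros x y.
    specialize (H x y). specialize (H' x y).
    apply Rabs_le_between in H. apply Rabs_le_between in H'.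
    apply Rabs_le_between. lra.
  - intros d Hd. split.
    + intros HUd. destruct (HU d Hd HUd) as [r [Hr H]].
      destruct (archimed_cor1 r Hr) as [N [HN HN0]]. exists N. intros e He Hde.
      apply H; [exact He|]. eapply Rbar_lt_le_trans; [exact Hde|]. simpl.
      apply Rle_trans with (/ INR N); [|lra].
      apply Rinv_le_contravar; [now apply lt_0_INR|lra].
    + intros [n Hn]. apply Hn; [exact Hd|]. apply DGamma_lt_iff. exists 0. split.
      * apply Rinv_0_lt_compat. pose proof (pos_INR n). lra.
      * intros x y. replace (d x y - d x y) with 0 by ring. rewrite Rabs_R0. lra.
Qed.

Lemma met_closed_Gdelta (C : metricfun -> Prop) : met_closed C -> met_Gdelta C.
Proof.
  intros HC. apply met_Gdelta_ext with (fun d => ~ ~ C d).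
  - intros d _. split; [tauto|apply NNPP].
  - apply met_Gdelta_not. now apply met_open_Fsigma.
Qed.

(** Each open [G n] is itself F_sigma, so the intersection over [n] is already of the required form.
    The next lemma is dual, with closed pieces seen as G_delta. *)
Lemma met_Fsigma_and_Gdelta_Fsigmadelta (A B : metricfun -> Prop) :
  met_Fsigma A -> met_Gdelta B -> met_Fsigmadelta (fun d => A d /\ B d).
Proof.
  intros HA [G [HG HB]]. exists (fun n d => A d /\ G n d). split.
  - intros n. apply met_Fsigma_and; [exact HA|]. now apply met_open_Fsigma.
  - intros d Hd. rewrite (HB d Hd). split.
    + intros [H1 H2] n. now split.
    + intros H. split; [apply (H 0%nat)|]. intros n. apply H.
Qed.

Lemma met_Fsigma_and_Gdelta_Gdeltasigma (A B : metricfun -> Prop) :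
  met_Fsigma A -> met_Gdelta B -> met_Gdeltasigma (fun d => A d /\ B d).
Proof.
  intros [F [HF HA]] HB. exists (fun n d => F n d /\ B d). split.
  - intros n. apply met_Gdelta_and; [now apply met_closed_Gdelta|exact HB].
  - intros d Hd. rewrite (HA d Hd). split.
    + intros [[n Hn] H]. exists n. now split.
    + intros [n [Hn H]]. split; [now exists n|exact H].
Qed.

Lemma met_Fsigma_true : met_Fsigma (fun _ => True).
Proof.
  exists (fun _ _ => True). split.
  - intros n d _ H. tauto.
  - intros d _. split; [intros _; now exists 0%nat|trivial].
Qed.

Lemma met_Gdelta_true : met_Gdelta (fun _ => True).
Proof.
  exists (fun _ _ => True). split.
  - intros n d _ _. exists 1. split; [lra|trivial].
  - intros d _. split; trivial.
Qed.

(** * Doubling, uniform disconnectedness and uniform perfectness *)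

(* [D] and [s] only bound the diameter and the separation of [A]; this spares the
   computation of suprema and allows lists with fewer than two points. *)
Definition doubling_on (d : metricfun) (P : Gamma -> Prop) : Prop :=
  exists (k : nat) (C : R), 1 <= C /\
    forall (A : list Gamma) (D s : R), NoDup A -> (forall x, In x A -> P x) ->
      0 < s <= D ->
      (forall x y, In x A -> In y A -> d x y <= D) ->
      (forall x y, In x A -> In y A -> x <> y -> s <= d x y) ->
      INR (length A) <= C * (D / s) ^ k.

Lemma finite_max_exists (T : Type) (f : T -> R) (l : list T) :
  l <> nil -> exists x, In x l /\ forall y, In y l -> f y <= f x.
Proof.
  induction l as [|a l IH]; [easy|]. intros _.
  destruct l as [|b l].
  - exists a. split; [now left|]. intros y [->|[]]. lra.
  - destruct IH as [x [Hx H]]; [easy|].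
    destruct (Rle_dec (f a) (f x)) as [Hle|Hgt].
    + exists x. split; [now right|]. intros y [->|Hy]; [exact Hle|now apply H].
    + exists a. split; [now left|]. intros y [->|Hy]; [lra|].
      apply H in Hy. lra.
Qed.

Lemma fin_diam_spec (d : metricfun) (A : list Gamma) : A <> nil ->
  (forall x y, In x A -> In y A -> d x y <= fin_diam d A) /\
  forall D, (forall x y, In x A -> In y A -> d x y <= D) -> fin_diam d A <= D.
Proof.
  intros HA. unfold fin_diam.
  destruct (Lub_Rbar_correct (fun t => exists x y, In x A /\ In y A /\ t = d x y))
    as [Hub Hlub].
  set (L := Lub_Rbar _) in *.
  destruct (finite_max_exists _ (fun p => d (fst p) (snd p)) (list_prod A A))
    as [[x0 y0] [Hin Hmax]].
  { destruct A; [easy|]. discriminate. }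
  apply in_prod_iff in Hin. destruct Hin as [Hx0 Hy0]. simpl in Hmax.
  assert (HL : Rbar_le L (d x0 y0)).
  { apply Hlub. intros t [x [y [Hx [Hy ->]]]].
    apply (Hmax (x, y)). now apply in_prod. }
  assert (HL' : Rbar_le (d x0 y0) L) by (apply Hub; now exists x0, y0).
  destruct L as [l| |]; simpl in HL, HL'; try contradiction. simpl. split.
  - intros x y Hx Hy. apply (Hub (d x y)). now exists x, y.
  - intros D HD. specialize (HD x0 y0 Hx0 Hy0). lra.
Qed.

Lemma fin_sep_spec (d : metricfun) (A : list Gamma) : is_metric d ->
  NoDup A -> (2 <= length A)%nat ->
  (exists x y, In x A /\ In y A /\ x <> y /\ fin_sep d A = d x y) /\
  (forall x y, In x A -> In y A -> x <> y -> fin_sep d A <= d x y).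
Proof.
  intros Hd HN HA. unfold fin_sep.
  destruct (Glb_Rbar_correct
    (fun t => exists x y, In x A /\ In y A /\ x <> y /\ t = d x y)) as [Hlb Hglb].
  set (L := Glb_Rbar _) in *.
  set (neq := fun p : Gamma * Gamma =>
    if excluded_middle_informative (fst p = snd p) then false else true).
  assert (Hneq : forall p, In p (filter neq (list_prod A A)) <->
    In (fst p) A /\ In (snd p) A /\ fst p <> snd p).
  { intros [x y]. rewrite filter_In, in_prod_iff. unfold neq. simpl.
    destruct (excluded_middle_informative (x = y)); intuition congruence. }
  destruct (finite_max_exists _ (fun p => - d (fst p) (snd p))
    (filter neq (list_prod A A))) as [[x0 y0] [Hin Hmax]].
  { destruct A as [|a [|b A]]; simpl in HA; try lia.
    intros HE. assert (Hab : In (a, b) nil) by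
      (rewrite <- HE; apply Hneq; simpl; repeat split; auto;
       intros ->; inversion HN as [|? ? Hb]; apply Hb; now left).
    exact Hab. }
  apply Hneq in Hin. simpl in Hin, Hmax. destruct Hin as [Hx0 [Hy0 Hxy0]].
  assert (HL : Rbar_le (d x0 y0) L).
  { apply Hglb. intros t [x [y [Hx [Hy [Hxy ->]]]]]. simpl.
    assert (H := Hmax (x, y)). simpl in H. apply Ropp_le_cancel, H.
    apply Hneq. now simpl. }
  assert (HL' : Rbar_le L (d x0 y0)) by (apply Hlb; now exists x0, y0).
  destruct L as [l| |]; simpl in HL, HL'; try contradiction. simpl. split.
  - exists x0, y0. repeat split; try assumption. lra.
  - intros x y Hx Hy Hxy. apply (Hlb (d x y)). now exists x, y.
Qed.

Lemma metric_pos (d : metricfun) (x y : Gamma) : is_metric d -> x <> y -> 0 < d x y.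
Proof.
  intros [H0 [Hz _]] Hxy. destruct (H0 x y) as [H|H]; [exact H|].
  exfalso. apply Hxy, Hz. now symmetry.
Qed.

Lemma Rdiv_ge_1 (D s : R) : 0 < s <= D -> 1 <= D / s.
Proof.
  intros H. apply Rmult_le_reg_r with s; [lra|].
  unfold Rdiv. rewrite Rmult_assoc, Rinv_l; lra.
Qed.

Lemma exists_nat_ge (x : R) : exists n : nat, x <= INR n.
Proof.
  destruct (INR_unbounded x) as [n Hn]. exists n. lra.
Qed.

Lemma doubling_iff (d : metricfun) : is_metric d ->
  (doubling d <-> doubling_on d (fun _ => True)).
Proof.
  intros Hd. split.
  - intros [beta [C [Hb [HC H]]]].
    destruct (exists_nat_ge beta) as [k Hk]. exists k, C. split; [exact HC|].
    intros A D s HN _ [Hs HDs] HD Hsep.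
    assert (H1 : 1 <= D / s) by now apply Rdiv_ge_1.
    destruct (le_lt_dec 2 (length A)) as [Hl|Hl].
    + eapply Rle_trans; [apply H; assumption|].
      apply Rmult_le_compat_l; [lra|].
      destruct (fin_sep_spec d A Hd HN Hl) as [[x [y [Hx [Hy [Hxy E]]]]] _].
      destruct (fin_diam_spec d A) as [HD1 HD2]; [destruct A; simpl in Hl; [lia|easy]|].
      assert (Hp := metric_pos d x y Hd Hxy).
      specialize (HD1 x y Hx Hy). specialize (HD2 D HD).
      specialize (Hsep x y Hx Hy Hxy). rewrite E in *.
      assert (Hq : 0 < fin_diam d A / d x y) by (apply Rdiv_lt_0_compat; lra).
      rewrite <- Rpower_pow by lra.
      apply Rle_trans with (Rpower (D / s) beta).
      * apply Rle_Rpower_l; [lra|]. split; [exact Hq|].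
        unfold Rdiv. apply Rmult_le_compat; try lra.
        -- left. now apply Rinv_0_lt_compat.
        -- now apply Rinv_le_contravar.
      * now apply Rle_Rpower.
    + apply Rle_trans with 1.
      * apply (le_INR (length A) 1). lia.
      * rewrite <- (Rmult_1_r 1). apply Rmult_le_compat; try lra.
        now apply pow_R1_Rle.
  (* The exponent must be positive and [k] may be 0, hence [S k]; raising it is harmless because the
     ratio is at least 1. *)
  - intros [k [C [HC H]]]. exists (INR (S k)), C.
    split; [apply lt_0_INR; lia|]. split; [exact HC|].
    intros A HN Hl.
    destruct (fin_sep_spec d A Hd HN Hl) as [[x [y [Hx [Hy [Hxy E]]]]] Hs].
    destruct (fin_diam_spec d A) as [HD1 _]; [destruct A; simpl in Hl; [lia|easy]|].
    assert (Hp := metric_pos d x y Hd Hxy). assert (Hxd := HD1 x y Hx Hy).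
    rewrite <- E in Hp, Hxd.
    assert (H1 : 1 <= fin_diam d A / fin_sep d A) by now apply Rdiv_ge_1.
    eapply Rle_trans; [now apply (H A (fin_diam d A) (fin_sep d A))|].
    apply Rmult_le_compat_l; [lra|]. rewrite Rpower_pow by lra.
    apply Rle_pow; [exact H1|lia].
Qed.

(* Asking for the room [eps] makes the condition closed; it costs a factor [4 ^ n]. *)
Lemma Fsigma_doubling : met_Fsigma doubling.
Proof.
  apply met_Fsigma_ext with (A := fun d => exists n : nat,
    forall (A : list Gamma) (D s eps : R), NoDup A -> 0 < s <= D -> 0 < eps ->
      (forall x y, In x A -> In y A -> d x y <= D - eps) ->
      (forall x y, In x A -> In y A -> x <> y -> s + eps <= d x y) ->
      INR (length A) <= INR n * (D / s) ^ n).
  - intros d [Hd _]. rewrite (doubling_iff d Hd). split.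
    + intros [k [C [HC H]]]. destruct (exists_nat_ge C) as [m Hm].
      exists (max k m). intros A D s eps HN HsD He HD Hs.
      assert (H1 : 1 <= D / s) by now apply Rdiv_ge_1.
      eapply Rle_trans; [apply (H A D s); auto|].
      * intros x y Hx Hy. specialize (HD x y Hx Hy). lra.
      * intros x y Hx Hy Hxy. specialize (Hs x y Hx Hy Hxy). lra.
      * apply Rmult_le_compat; [lra| |
          |apply Rle_pow; [exact H1|lia]].
        -- left. apply pow_lt. lra.
        -- apply Rle_trans with (INR m); [exact Hm|apply le_INR; lia].
    (* The summand 1 secures [1 <= C], since [n] may be 0. *)
    + intros [n H]. exists n, (INR n * 4 ^ n + 1).
      assert (Hc : 0 <= INR n * 4 ^ n)
        by (apply Rmult_le_pos; [apply pos_INR|left; apply pow_lt; lra]).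
      split; [lra|].
      intros A D s HN _ HsD HD Hs.
      assert (Hq : 0 < D / s) by (apply Rdiv_lt_0_compat; lra).
      (* The room [s / 2] fits: [D <= 2 * D - s / 2] because [s <= D], and [s / 2 + s / 2 = s]. *)
      eapply Rle_trans; [apply (H A (2 * D) (s / 2) (s / 2)); auto; try lra|].
      * intros x y Hx Hy. specialize (HD x y Hx Hy). lra.
      * intros x y Hx Hy Hxy. specialize (Hs x y Hx Hy Hxy). lra.
      * replace (2 * D / (s / 2)) with (4 * (D / s)) by (field; lra).
        rewrite Rpow_mult_distr.
        assert (0 < (D / s) ^ n) by now apply pow_lt. nra.
  - eexists. split; [|intros d _; apply iff_refl].
    intros n d Hd Hn.
    apply not_all_ex_not in Hn. destruct Hn as [A Hn].
    apply not_all_ex_not in Hn. destruct Hn as [D Hn].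
    apply not_all_ex_not in Hn. destruct Hn as [s Hn].
    apply not_all_ex_not in Hn. destruct Hn as [eps Hn].
    assert (HA : NoDup A) by tauto. assert (HsD : 0 < s <= D) by tauto.
    assert (He : 0 < eps) by tauto.
    exists (eps / 2). split; [lra|]. intros e _ Hde Hall.
    apply Hn. intros _ _ _ HD Hs. apply (Hall A D s (eps / 2)); auto; try lra.
    + intros x y Hx Hy. specialize (HD x y Hx Hy).
      pose proof (DGamma_lt_close _ _ _ Hde x y). lra.
    + intros x y Hx Hy Hxy. specialize (Hs x y Hx Hy Hxy).
      pose proof (DGamma_lt_close _ _ _ Hde x y). lra.
Qed.

Lemma max_gap_le (d : metricfun) (z : nat -> Gamma) (N : nat) (eta : R) : 0 <= eta ->
  (forall i, (i < N - 1)%nat -> d (z i) (z (S i)) <= eta) -> max_gap d z N <= eta.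
Proof.
  intros He H. unfold max_gap.
  assert (H' : forall i, In i (seq 0 (N - 1)) -> d (z i) (z (S i)) <= eta).
  { intros i Hi. apply in_seq in Hi. apply H. lia. }
  clear H. induction (seq 0 (N - 1)) as [|i l IH]; simpl; [exact He|].
  apply Rmax_lub; [apply H'; now left|]. apply IH. intros j Hj. apply H'. now right.
Qed.

Lemma max_gap_ge (d : metricfun) (z : nat -> Gamma) (N i : nat) :
  (i < N - 1)%nat -> d (z i) (z (S i)) <= max_gap d z N.
Proof.
  intros Hi. unfold max_gap.
  assert (H : In i (seq 0 (N - 1))) by (apply in_seq; lia).
  induction (seq 0 (N - 1)) as [|j l IH]; simpl; [easy|].
  destruct H as [->|H]; [apply Rmax_l|].
  eapply Rle_trans; [now apply IH|apply Rmax_r].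
Qed.

Lemma max_gap_nonneg (d : metricfun) (z : nat -> Gamma) (N : nat) : 0 <= max_gap d z N.
Proof.
  unfold max_gap. induction (seq 0 (N - 1)) as [|j l IH]; simpl; [lra|].
  eapply Rle_trans; [exact IH|apply Rmax_r].
Qed.

(** A free bound [eta] on the steps replaces the fold in [max_gap], which makes it easy to pass to a
    nearby metric. Here [N] counts steps rather than points. *)
Definition chain_bound (d : metricfun) (delta : R) : Prop :=
  forall (N : nat) (z : nat -> Gamma) (eta : R), 0 <= eta ->
    (forall i, (i < N)%nat -> d (z i) (z (S i)) <= eta) ->
    delta * d (z 0%nat) (z N) <= eta.

Lemma unif_disconnected_iff (d : metricfun) : is_metric d ->
  (unif_disconnected d <-> exists delta, 0 < delta < 1 /\ chain_bound d delta).
Proof.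
  intros [H0 [Hz [Hsym Htri]]]. split.
  - intros [delta [Hd H]]. exists delta. split; [exact Hd|].
    intros N z eta He Hs.
    destruct (classic (z 0%nat = z N)) as [E|E].
    { rewrite (proj2 (Hz _ _) E). lra. }
    eapply Rle_trans with (max_gap d z (S N)).
    + specialize (H (S N) z). replace (S N - 1)%nat with N in H by lia. apply H.
      exists 0%nat, N. repeat split; try lia. exact E.
    + apply max_gap_le; [exact He|]. intros i Hi. apply Hs. lia.
  - intros [delta [Hd H]]. exists delta. split; [exact Hd|].
    intros N z _. apply (H (N - 1)%nat z); [apply max_gap_nonneg|].
    intros i Hi. now apply max_gap_ge.
Qed.

(** For a fixed constant, a violation is a finite chain together with a strict inequality. It
    persists under small perturbations once [eta] is enlarged accordingly. *)
Lemma Fsigma_unif_disconnected : met_Fsigma unif_disconnected.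
Proof.
  apply met_Fsigma_ext with (A := fun d => exists n : nat, chain_bound d (/ (INR n + 2))).
  - intros d [Hd _]. rewrite (unif_disconnected_iff d Hd). split.
    + intros [delta [[Hd0 Hd1] H]].
      destruct (exists_nat_ge (/ delta)) as [n Hn]. exists n.
      intros N z eta He Hs. apply Rle_trans with (delta * d (z 0%nat) (z N));
        [|now apply H].
      apply Rmult_le_compat_r; [apply Hd|].
      rewrite <- (Rinv_inv delta). apply Rinv_le_contravar; [|lra].
      now apply Rinv_0_lt_compat.
    (* The shift by 2 keeps the constant strictly below 1 even for [n = 0]. *)
    + intros [n H]. exists (/ (INR n + 2)). split; [|exact H].
      pose proof (pos_INR n). split; [apply Rinv_0_lt_compat; lra|].
      rewrite <- Rinv_1. apply Rinv_lt_contravar; lra.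
  - eexists. split; [|intros d _; apply iff_refl].
    intros n d Hd Hn. set (delta := / (INR n + 2)) in *.
    assert (Hdelta : 0 < delta <= 1).
    { pose proof (pos_INR n). split; [apply Rinv_0_lt_compat; lra|].
      rewrite <- Rinv_1. apply Rinv_le_contravar; lra. }
    apply not_all_ex_not in Hn. destruct Hn as [N Hn].
    apply not_all_ex_not in Hn. destruct Hn as [z Hn].
    apply not_all_ex_not in Hn. destruct Hn as [eta Hn].
    apply imply_to_and in Hn. destruct Hn as [He Hn].
    apply imply_to_and in Hn. destruct Hn as [Hs Hn]. apply Rnot_le_lt in Hn.
    (* A quarter of the excess: enlarging [eta] costs one [g], the moved endpoint distance at most
       another, and the total of [2 * g] stays below the excess. *)
    set (g := (delta * d (z 0%nat) (z N) - eta) / 4).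
    exists g. split; [unfold g; lra|]. intros e _ Hde Hall.
    assert (Hc := DGamma_lt_close _ _ _ Hde).
    assert (H : delta * e (z 0%nat) (z N) <= eta + g).
    { apply Hall; [unfold g; lra|]. intros i Hi. specialize (Hs i Hi).
      specialize (Hc (z i) (z (S i))). lra. }
    specialize (Hc (z 0%nat) (z N)).
    assert (delta * (d (z 0%nat) (z N) - g) <= delta * e (z 0%nat) (z N))
      by (apply Rmult_le_compat_l; lra).
    assert (delta * g <= g) by (assert (0 < g) by (unfold g; lra); nra).
    unfold g in *. lra.
Qed.

(** The witness [y] changes with the metric, so closedness comes from the room [eps]: if every [y]
    misses the interval widened by [eps], then after a perturbation below [eps / 2] it still misses
    the one widened by [eps / 2]. The pair [a], [b] records that [r] is below the diameter, a strict
    inequality that also survives. *)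
Lemma Fsigma_unif_perfect : met_Fsigma unif_perfect.
Proof.
  apply met_Fsigma_ext with (A := fun d => exists n : nat,
    forall x r eps a b, 0 < r < d a b -> 0 < eps ->
      exists y, / (INR n + 1) * r - eps <= d x y <= r + eps).
  - intros d [Hd _]. split.
    + intros [c [[Hc0 Hc1] H]]. destruct (exists_nat_ge (/ c)) as [n Hn]. exists n.
      intros x r eps a b [Hr Hab] He.
      destruct (H x r Hr) as [y Hy]; [apply diam_space_gt_iff; now exists a, b|].
      exists y. assert (/ (INR n + 1) <= c).
      { rewrite <- (Rinv_inv c). apply Rinv_le_contravar; [|lra].
        now apply Rinv_0_lt_compat. }
      split; [|lra]. nra.
    + intros [n H]. set (c := / (INR n + 1)) in *.
      assert (Hc : 0 < c <= 1).
      { pose proof (pos_INR n). split; [apply Rinv_0_lt_compat; lra|].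
        rewrite <- Rinv_1. apply Rinv_le_contravar; lra. }
      exists (c / 4). split; [lra|]. intros x r Hr Hdiam.
      apply diam_space_gt_iff in Hdiam. destruct Hdiam as [a [b Hab]].
      (* With half the radius and room [c * r / 4], the lower bound becomes [c / 4 * r] and the
         upper one stays below [r]. *)
      destruct (H x (r / 2) (c * r / 4) a b) as [y Hy]; [lra|nra|].
      exists y. nra.
  - eexists. split; [|intros d _; apply iff_refl].
    intros n d Hd Hn.
    apply not_all_ex_not in Hn. destruct Hn as [x Hn].
    apply not_all_ex_not in Hn. destruct Hn as [r Hn].
    apply not_all_ex_not in Hn. destruct Hn as [eps Hn].
    apply not_all_ex_not in Hn. destruct Hn as [a Hn].
    apply not_all_ex_not in Hn. destruct Hn as [b Hn].
    apply imply_to_and in Hn. destruct Hn as [Hr Hn].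
    apply imply_to_and in Hn. destruct Hn as [He Hn].
    exists (Rmin (eps / 2) (d a b - r)). split; [apply Rmin_pos; lra|].
    intros e _ Hde Hall. assert (Hc := DGamma_lt_close _ _ _ Hde).
    assert (H1 := Rmin_l (eps / 2) (d a b - r)).
    assert (H2 := Rmin_r (eps / 2) (d a b - r)).
    destruct (Hall x r (eps / 2) a b) as [y Hy]; [|lra|].
    + specialize (Hc a b). lra.
    + apply Hn. exists y. specialize (Hc x y). lra.
Qed.

(** * Sums over binary sequences *)

(* [t n] is the mass carried by the digits from [n] on, so digit [n] has weight
   [t n - t (S n)] and [t n - 2 * t (S n)] is the width of the gap it creates. *)
Definition tail_seq (t : nat -> R) : Prop :=
  (forall n, 0 < t n) /\ (forall n, 2 * t (S n) < t n) /\ is_lim_seq t 0.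

Definition digit_term (t : nat -> R) (a : nat -> bool) (n : nat) : R :=
  if a n then t n - t (S n) else 0.

Definition tail_sum (t : nat -> R) (n : nat) (a : nat -> bool) : R :=
  Series (fun k => digit_term t a (n + k)).

Lemma is_series_telescope (t : nat -> R) (n : nat) : is_lim_seq t 0 ->
  is_series (fun k => t (n + k)%nat - t (S (n + k))) (t n).
Proof.
  intros Hlim.
  assert (Hsum : forall k, sum_n (fun k => t (n + k)%nat - t (S (n + k))) k
    = t n - t (k + S n)%nat).
  { induction k as [|k IH].
    - rewrite sum_O, Nat.add_0_r. reflexivity.
    - rewrite sum_Sn, IH. unfold plus; simpl.
      replace (n + S k)%nat with (k + S n)%nat by lia. ring. }
  assert (H : is_lim_seq (sum_n (fun k => t (n + k)%nat - t (S (n + k)))) (t n)).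
  { apply is_lim_seq_ext with (fun k => t n - t (k + S n)%nat); [easy|].
    replace (Finite (t n)) with (Finite (t n - 0)) by (f_equal; ring).
    apply is_lim_seq_minus'; [apply is_lim_seq_const|].
    now apply (is_lim_seq_incr_n t). }
  exact H.
Qed.

Section TailSum.
Variable t : nat -> R.
Hypothesis Ht : tail_seq t.

Lemma digit_term_bounds (a : nat -> bool) (n : nat) :
  0 <= digit_term t a n <= t n - t (S n).
Proof.
  destruct Ht as [Hp [Hg _]]. unfold digit_term.
  specialize (Hg n). pose proof (Hp (S n)). destruct (a n); lra.
Qed.

Lemma ex_series_digit_term (a : nat -> bool) (n : nat) :
  ex_series (fun k => digit_term t a (n + k)).
Proof.
  apply (ex_series_le (V := R_CompleteNormedModule)) with
    (fun k => t (n + k)%nat - t (S (n + k))).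
  - intros k. pose proof (digit_term_bounds a (n + k)).
    change (Rabs (digit_term t a (n + k)) <= t (n + k)%nat - t (S (n + k))).
    rewrite Rabs_right; lra.
  - exists (t n). apply is_series_telescope, Ht.
Qed.

Lemma tail_sum_step (n : nat) (a : nat -> bool) :
  tail_sum t n a = digit_term t a n + tail_sum t (S n) a.
Proof.
  unfold tail_sum. rewrite Series_incr_1 by apply ex_series_digit_term.
  rewrite Nat.add_0_r. f_equal. apply Series_ext. intros k.
  now rewrite Nat.add_succ_r.
Qed.

Lemma tail_sum_bounds (n : nat) (a : nat -> bool) : 0 <= tail_sum t n a <= t n.
Proof.
  split.
  - unfold tail_sum. rewrite <- (Rmult_0_l (Series (fun _ => 0))), <- Series_scal_l.
    apply Series_le; [|apply ex_series_digit_term].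
    intros k. pose proof (digit_term_bounds a (n + k)). lra.
  - rewrite <- (is_series_unique _ _ (is_series_telescope t n (proj2 (proj2 Ht)))).
    apply Series_le.
    + intros k. apply digit_term_bounds.
    + exists (t n). apply is_series_telescope, Ht.
Qed.

Lemma tail_sum_ext (n : nat) (a b : nat -> bool) :
  (forall i, (n <= i)%nat -> a i = b i) -> tail_sum t n a = tail_sum t n b.
Proof.
  intros H. apply Series_ext. intros k. unfold digit_term.
  now rewrite H by lia.
Qed.

Lemma tail_sum_true (n : nat) (a : nat -> bool) :
  (forall i, (n <= i)%nat -> a i = true) -> tail_sum t n a = t n.
Proof.
  intros H. apply is_series_unique.
  apply is_series_ext with (fun k => t (n + k)%nat - t (S (n + k))).
  - intros k. unfold digit_term. now rewrite H by lia.
  - apply is_series_telescope, Ht.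
Qed.

Lemma tail_sum_false (n : nat) (a : nat -> bool) :
  (forall i, (n <= i)%nat -> a i = false) -> tail_sum t n a = 0.
Proof.
  intros H. unfold tail_sum.
  rewrite (Series_ext _ (fun k => 0 * digit_term t a (n + k))).
  - rewrite Series_scal_l. ring.
  - intros k. unfold digit_term. rewrite H by lia. ring.
Qed.

Lemma tail_sum_diff (n : nat) (a b : nat -> bool) :
  (forall i, (i < n)%nat -> a i = b i) ->
  tail_sum t 0 a - tail_sum t 0 b = tail_sum t n a - tail_sum t n b.
Proof.
  induction n as [|n IH]; intros H; [reflexivity|].
  rewrite IH by (intros i Hi; apply H; lia).
  rewrite (tail_sum_step n a), (tail_sum_step n b).
  unfold digit_term. rewrite (H n) by lia. ring.
Qed.

Lemma tail_sum_diff_le (n : nat) (a b : nat -> bool) :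
  (forall i, (i < n)%nat -> a i = b i) ->
  Rabs (tail_sum t 0 a - tail_sum t 0 b) <= t n.
Proof.
  intros H. rewrite (tail_sum_diff n) by exact H.
  pose proof (tail_sum_bounds n a). pose proof (tail_sum_bounds n b).
  apply Rabs_le_between. lra.
Qed.

(** One tail lies in [[0, t (S n)]], the other in [[t n - t (S n), t n]]; the bound is the gap
    between these intervals. *)
Lemma tail_sum_diff_ge (n : nat) (a b : nat -> bool) :
  (forall i, (i < n)%nat -> a i = b i) -> a n <> b n ->
  t n - 2 * t (S n) <= Rabs (tail_sum t 0 a - tail_sum t 0 b).
Proof.
  intros H Hn. rewrite (tail_sum_diff n) by exact H.
  rewrite (tail_sum_step n a), (tail_sum_step n b).
  pose proof (tail_sum_bounds (S n) a). pose proof (tail_sum_bounds (S n) b).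
  unfold digit_term. destruct (a n), (b n); try congruence.
  - eapply Rle_trans; [|apply Rle_abs]. lra.
  - rewrite <- Rabs_Ropp. eapply Rle_trans; [|apply Rle_abs]. lra.
Qed.

Lemma tail_sum_diff_single (n : nat) (a b : nat -> bool) :
  (forall i, i <> n -> a i = b i) -> a n <> b n ->
  Rabs (tail_sum t 0 a - tail_sum t 0 b) = t n - t (S n).
Proof.
  intros H Hn. rewrite (tail_sum_diff n) by (intros i Hi; apply H; lia).
  rewrite (tail_sum_step n a), (tail_sum_step n b).
  rewrite (tail_sum_ext (S n) a b) by (intros i Hi; apply H; lia).
  pose proof (digit_term_bounds (fun _ => true) n) as Hb. unfold digit_term in *.
  destruct (a n), (b n); try congruence.
  - rewrite Rabs_right; lra.
  - rewrite Rabs_left1; lra.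
Qed.
End TailSum.

Lemma first_difference (a b : nat -> bool) (i : nat) : a i <> b i ->
  exists n, (forall i, (i < n)%nat -> a i = b i) /\ a n <> b n.
Proof.
  induction i as [i IH] using lt_wf_ind. intros Hi.
  destruct (classic (exists j, (j < i)%nat /\ a j <> b j)) as [[j [Hj Hab]]|Hn].
  - now apply (IH j).
  - exists i. split; [|exact Hi]. intros j Hj. apply NNPP. intros Hab.
    apply Hn. now exists j.
Qed.

(** * Binary coding of the Cantor set *)

(** Tail masses of the middle-third set: [t3 n - t3 (S n)] is the weight [2 / 3 ^ S n] of digit [n]
    in [in_cantor]. *)
Definition t3 (n : nat) : R := / 3 ^ n.

Lemma tail_seq_t3 : tail_seq t3.
Proof.
  assert (Hp : forall n, 0 < t3 n)
    by (intros n; apply Rinv_0_lt_compat, pow_lt; lra).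
  split; [exact Hp|]. split.
  - intros n. specialize (Hp n). unfold t3 in *. simpl.
    rewrite Rinv_mult. lra.
  - apply is_lim_seq_ext with (fun n => (/ 3) ^ n).
    + intros n. unfold t3. now rewrite pow_inv.
    + apply is_lim_seq_geom. rewrite Rabs_right; lra.
Qed.

Lemma digit_term_t3 (a : nat -> bool) (n : nat) :
  (if a n then 2 else 0) / 3 ^ S n = digit_term t3 a n.
Proof.
  unfold digit_term, t3. assert (3 ^ n <> 0) by (apply pow_nonzero; lra).
  simpl. destruct (a n); field; lra.
Qed.

Lemma in_cantor_tail_sum (a : nat -> bool) : in_cantor (tail_sum t3 0 a).
Proof.
  exists a. apply is_series_ext with (fun n => digit_term t3 a n).
  - intros n. symmetry. apply digit_term_t3.
  - apply Series_correct, (ex_series_digit_term _ tail_seq_t3 a 0).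
Qed.

Definition gam (a : nat -> bool) : Gamma := exist _ _ (in_cantor_tail_sum a).

Definition dig (x : Gamma) : nat -> bool :=
  proj1_sig (constructive_indefinite_description _ (proj2_sig x)).

Lemma proj1_sig_dig (x : Gamma) : proj1_sig x = tail_sum t3 0 (dig x).
Proof.
  unfold dig. destruct (constructive_indefinite_description _ _) as [a Ha]. simpl.
  symmetry. apply is_series_unique. revert Ha. apply is_series_ext.
  intros n. apply digit_term_t3.
Qed.

Lemma tail_sum_inj (t : nat -> R) (a b : nat -> bool) : tail_seq t ->
  tail_sum t 0 a = tail_sum t 0 b -> forall i, a i = b i.
Proof.
  intros Ht E i. apply NNPP. intros Hi.
  destruct (first_difference a b i Hi) as [n [H Hn]].
  pose proof (tail_sum_diff_ge t Ht n a b H Hn) as Hge.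
  rewrite E, Rminus_diag, Rabs_R0 in Hge.
  destruct Ht as [_ [Hg _]]. specialize (Hg n). lra.
Qed.

Lemma dig_gam (a : nat -> bool) (i : nat) : dig (gam a) i = a i.
Proof.
  apply (tail_sum_inj t3 _ _ tail_seq_t3). rewrite <- proj1_sig_dig. reflexivity.
Qed.

Lemma Gamma_ext (x y : Gamma) : (forall i, dig x i = dig y i) -> x = y.
Proof.
  intros H.
  assert (E : proj1_sig x = proj1_sig y).
  { rewrite !proj1_sig_dig. apply tail_sum_ext. intros i _. apply H. }
  destruct x as [x Hx], y as [y Hy]. simpl in E. subst y.
  f_equal. apply proof_irrelevance.
Qed.

Definition agree (x y : Gamma) (n : nat) : Prop :=
  forall i, (i < n)%nat -> dig x i = dig y i.

Lemma agree_refl (x : Gamma) (n : nat) : agree x x n.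
Proof. now intros i _. Qed.

Lemma agree_sym (x y : Gamma) (n : nat) : agree x y n -> agree y x n.
Proof. intros H i Hi. symmetry. now apply H. Qed.

Lemma agree_trans (x y z : Gamma) (n : nat) : agree x y n -> agree y z n -> agree x z n.
Proof. intros H H' i Hi. rewrite (H i Hi). now apply H'. Qed.

Lemma agree_le (x y : Gamma) (m n : nat) : (m <= n)%nat -> agree x y n -> agree x y m.
Proof. intros Hm H i Hi. apply H. lia. Qed.

Lemma agree_S (x y : Gamma) (n : nat) : agree x y n -> dig x n = dig y n ->
  agree x y (S n).
Proof.
  intros H E i Hi. destruct (Nat.eq_dec i n) as [->|Hne]; [exact E|apply H; lia].
Qed.

Definition upd (x : Gamma) (n : nat) (b : bool) : Gamma :=
  gam (fun i => if i =? n then b else dig x i).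

(** For a metric from the line, [b] false and true give the left and right end of the cylinder of
    depth [n] around [x]. The left ends later serve as base points. *)
Definition fill (n : nat) (b : bool) (x : Gamma) : Gamma :=
  gam (fun i => if i <? n then dig x i else b).

Definition flip (x : Gamma) (n : nat) : Gamma := upd x n (negb (dig x n)).

Lemma dig_upd_eq (x : Gamma) (n : nat) (b : bool) : dig (upd x n b) n = b.
Proof. unfold upd. now rewrite dig_gam, Nat.eqb_refl. Qed.

Lemma dig_upd_neq (x : Gamma) (n i : nat) (b : bool) : i <> n ->
  dig (upd x n b) i = dig x i.
Proof.
  intros H. unfold upd. rewrite dig_gam. now apply Nat.eqb_neq in H as ->.
Qed.

Lemma dig_fill_lt (x : Gamma) (n i : nat) (b : bool) : (i < n)%nat ->
  dig (fill n b x) i = dig x i.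
Proof.
  intros H. unfold fill. rewrite dig_gam. now apply Nat.ltb_lt in H as ->.
Qed.

Lemma dig_fill_ge (x : Gamma) (n i : nat) (b : bool) : (n <= i)%nat ->
  dig (fill n b x) i = b.
Proof.
  intros H. unfold fill. rewrite dig_gam. now apply Nat.ltb_ge in H as ->.
Qed.

Lemma agree_upd (x : Gamma) (m n : nat) (b : bool) : (m <= n)%nat ->
  agree x (upd x n b) m.
Proof. intros H i Hi. rewrite dig_upd_neq by lia. reflexivity. Qed.

Lemma agree_fill (x : Gamma) (n : nat) (b : bool) : agree x (fill n b x) n.
Proof. intros i Hi. now rewrite dig_fill_lt. Qed.

Lemma fill_eq_iff (x y : Gamma) (n : nat) (b : bool) :
  fill n b x = fill n b y <-> agree x y n.
Proof.
  split.
  - intros E i Hi. now rewrite <- (dig_fill_lt x n i b Hi), E, dig_fill_lt.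
  - intros H. apply Gamma_ext. intros i.
    destruct (le_lt_dec n i) as [Hi|Hi].
    + now rewrite !dig_fill_ge.
    + rewrite !dig_fill_lt by exact Hi. now apply H.
Qed.

(** * Metrics on the Cantor set *)

Definition real_metric (t : nat -> R) : metricfun :=
  fun x y => Rabs (tail_sum t 0 (dig x) - tail_sum t 0 (dig y)).

Lemma deucl_real_metric (x y : Gamma) : deucl x y = real_metric t3 x y.
Proof. unfold deucl. now rewrite !proj1_sig_dig. Qed.

Lemma is_metric_real_metric (t : nat -> R) : tail_seq t -> is_metric (real_metric t).
Proof.
  intros Ht. unfold real_metric. repeat split.
  - intros x y. apply Rabs_pos.
  - intros H. apply Gamma_ext, (tail_sum_inj t _ _ Ht).
    destruct (Req_dec (tail_sum t 0 (dig x) - tail_sum t 0 (dig y)) 0) as [E|E]; [lra|].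
    now apply Rabs_no_R0 in E.
  - intros ->. now rewrite Rminus_diag, Rabs_R0.
  - intros x y. apply Rabs_minus_sym.
  - intros x y z. eapply Rle_trans; [|apply Rabs_triang]. right. f_equal. ring.
Qed.

(** Together with [small_agree] this says that [d] induces the product uniformity on digit
    sequences. By compactness nothing is lost in asking for uniform rather than pointwise
    smallness. *)
Definition agree_small (d : metricfun) : Prop :=
  forall eps, 0 < eps -> exists n, forall x y, agree x y n -> d x y < eps.

Definition small_agree (d : metricfun) : Prop :=
  forall n, exists eps, 0 < eps /\ forall x y, d x y < eps -> agree x y n.

Lemma is_lim_seq_0_small (t : nat -> R) (eps : R) : is_lim_seq t 0 -> 0 < eps ->
  exists n, t n < eps.
Proof.
  intros H He. apply is_lim_seq_spec in H.
  destruct (H (mkposreal eps He)) as [N HN]. exists N.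
  specialize (HN N (Nat.le_refl N)). simpl in HN.
  rewrite Rminus_0_r in HN. apply Rabs_lt_between in HN. lra.
Qed.

Lemma agree_small_real_metric (t : nat -> R) : tail_seq t -> agree_small (real_metric t).
Proof.
  intros Ht eps He. destruct (is_lim_seq_0_small t eps (proj2 (proj2 Ht)) He) as [n Hn].
  exists n. intros x y Hxy.
  eapply Rle_lt_trans; [|exact Hn]. now apply tail_sum_diff_le.
Qed.

Lemma small_agree_real_metric (t : nat -> R) : tail_seq t -> small_agree (real_metric t).
Proof.
  intros Ht n. induction n as [|n [eps [He IH]]].
  - exists 1. split; [lra|]. intros x y _ i Hi. lia.
  - exists (Rmin eps (t n - 2 * t (S n))). destruct (proj2 Ht) as [Hg _].
    specialize (Hg n). split; [apply Rmin_pos; lra|]. intros x y Hxy.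
    assert (H1 := Rmin_l eps (t n - 2 * t (S n))).
    assert (H2 := Rmin_r eps (t n - 2 * t (S n))).
    assert (Ha : agree x y n) by (apply IH; lra).
    apply agree_S; [exact Ha|]. apply NNPP. intros Hn.
    pose proof (tail_sum_diff_ge t Ht n _ _ Ha Hn). unfold real_metric in Hxy. lra.
Qed.

Lemma Met_of_agree (e : metricfun) : is_metric e -> agree_small e -> small_agree e -> Met e.
Proof.
  intros He H1 H2. split; [exact He|].
  assert (H : forall d d' : metricfun, agree_small d -> small_agree d' ->
    forall U, d_open d U -> d_open d' U).
  { intros d d' Hd Hd' U HU x Hx.
    destruct (HU x Hx) as [eps [Heps HUx]].
    destruct (Hd eps Heps) as [n Hn]. destruct (Hd' n) as [r [Hr Hr']].
    exists r. split; [exact Hr|]. intros y Hy. now apply HUx, Hn, Hr'. }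
  assert (H3 : agree_small deucl).
  { intros eps Heps. destruct (agree_small_real_metric t3 tail_seq_t3 eps Heps) as [n Hn].
    exists n. intros x y. rewrite deucl_real_metric. apply Hn. }
  assert (H4 : small_agree deucl).
  { intros n. destruct (small_agree_real_metric t3 tail_seq_t3 n) as [eps [Heps Hn]].
    exists eps. split; [exact Heps|]. intros x y. rewrite deucl_real_metric. apply Hn. }
  intros U. split; now apply H.
Qed.

(* König's lemma: otherwise some branch has all its cylinders of large oscillation,
   against continuity of [d] at the point it defines. *)
Lemma Met_agree_small (d : metricfun) : Met d -> agree_small d.
Proof.
  intros [[H0 [Hz [Hsym Htri]]] Hop] eps Heps.
  assert (Hpt : forall x r, 0 < r -> exists n, forall y, agree x y n -> d x y < r).
  { intros x r Hr.
    assert (HU : d_open d (fun y => d x y < r)).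
    { intros y Hy. exists (r - d x y). split; [lra|]. intros z Hyz.
      specialize (Htri x y z). lra. }
    apply Hop in HU. destruct (HU x) as [s [Hs HU']].
    - now rewrite (proj2 (Hz x x) eq_refl).
    - destruct (agree_small_real_metric t3 tail_seq_t3 s Hs) as [n Hn].
      exists n. intros y Hy. apply HU'. rewrite deucl_real_metric. now apply Hn. }
  apply NNPP. intros Hno.
  (* The cylinder of depth [n] around [x] is bad if it contains pairs that agree arbitrarily deep
     and yet stay [eps] apart. *)
  set (bad := fun n x => forall m, exists y z, agree x y n /\ agree x z n /\
    agree y z m /\ eps <= d y z).
  assert (Hstep : forall n x, exists x', bad n x -> agree x x' n /\ bad (S n) x').
  { intros n x. apply NNPP. intros Hn.
    assert (Hb : forall b, ~ bad (S n) (upd x n b)).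
    { intros b Hb. apply Hn. exists (upd x n b). intros _. split; [|exact Hb].
      now apply agree_upd. }
    apply Hn. exists x. intros Hbad. exfalso.
    destruct (not_all_ex_not _ _ (Hb false)) as [m0 Hm0].
    destruct (not_all_ex_not _ _ (Hb true)) as [m1 Hm1].
    (* Agreement beyond digit [n] puts the pair into one half of the cylinder; agreement beyond [m0]
       and [m1] contradicts the choice of the depth for that half. *)
    destruct (Hbad (max (S n) (max m0 m1))) as [y [z [Hy [Hz' [Hyz Hd]]]]].
    assert (Hu : forall w, agree x w n -> agree (upd x n (dig w n)) w (S n)).
    { intros w Hw. apply agree_S; [|apply dig_upd_eq].
      apply agree_trans with x; [|exact Hw].
      apply agree_sym. now apply agree_upd. }
    assert (E : dig y n = dig z n) by (apply Hyz; lia).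
    destruct (dig y n) eqn:Ey.
    - apply Hm1. exists y, z. repeat split; [| | |exact Hd].
      + rewrite <- Ey. now apply Hu.
      + rewrite E. now apply Hu.
      + apply agree_le with (2 := Hyz). lia.
    - apply Hm0. exists y, z. repeat split; [| | |exact Hd].
      + rewrite <- Ey. now apply Hu.
      + rewrite E. now apply Hu.
      + apply agree_le with (2 := Hyz). lia. }
  (* Dependent choice: keeping the implication inside makes [g] total, and it is then iterated from
     the whole space, which is bad by assumption. *)
  destruct (choice (fun (p : nat * Gamma) x' => bad (fst p) (snd p) ->
    agree (snd p) x' (fst p) /\ bad (S (fst p)) x')) as [g Hg].
  { intros [n x]. apply Hstep. }
  set (s := nat_rect (fun _ => Gamma) (gam (fun _ => false)) (fun n x => g (n, x))).
  assert (Hbad : forall n, bad n (s n)).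
  { induction n as [|n IH].
    - intros m. apply NNPP. intros Hm. apply Hno. exists m. intros x y Hxy.
      apply Rnot_le_lt. intros Hd. apply Hm. exists x, y.
      repeat split; try assumption; intros i Hi; lia.
    - apply (Hg (n, s n)), IH. }
  assert (Hs : forall n k, agree (s n) (s (k + n)%nat) n).
  { intros n k. induction k as [|k IH]; [apply agree_refl|].
    apply agree_trans with (1 := IH).
    apply agree_le with (k + n)%nat; [lia|].
    apply (Hg ((k + n)%nat, s (k + n)%nat)), Hbad. }
  (* Digit [i] is settled from stage [S i] on, so this diagonal point is the limit of the branch. *)
  set (y := gam (fun i => dig (s (S i)) i)).
  destruct (Hpt y (eps / 2)) as [n Hn]; [lra|].
  assert (Hy : agree y (s n) n).
  { intros i Hi. unfold y. rewrite dig_gam.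
    replace n with ((n - S i) + S i)%nat by lia. apply Hs. lia. }
  destruct (Hbad n 0%nat) as [u [v [Hu [Hv [_ Hd]]]]].
  assert (H1 := Hn u (agree_trans _ _ _ _ Hy Hu)).
  assert (H2 := Hn v (agree_trans _ _ _ _ Hy Hv)).
  specialize (Htri u y v). rewrite (Hsym u y) in Htri. lra.
Qed.

(** * Ultrametrics given by the first differing digit *)

Definition fdiff (x y : Gamma) : nat :=
  epsilon (inhabits 0%nat) (fun n => agree x y n /\ dig x n <> dig y n).

Lemma fdiff_spec (x y : Gamma) : x <> y ->
  agree x y (fdiff x y) /\ dig x (fdiff x y) <> dig y (fdiff x y).
Proof.
  intros Hxy. unfold fdiff. apply epsilon_spec.
  destruct (classic (exists i, dig x i <> dig y i)) as [[i Hi]|Hn].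
  - now apply (first_difference _ _ i).
  - exfalso. apply Hxy, Gamma_ext. intros i. apply NNPP. intros Hi.
    apply Hn. now exists i.
Qed.

Lemma agree_le_fdiff (x y : Gamma) (n : nat) : x <> y ->
  (agree x y n <-> (n <= fdiff x y)%nat).
Proof.
  intros Hxy. destruct (fdiff_spec x y Hxy) as [Ha Hd]. split.
  - intros H. apply Nat.nlt_ge. intros Hlt. apply Hd. now apply H.
  - intros H. now apply agree_le with (1 := H).
Qed.

Definition scale_seq (a : nat -> R) : Prop :=
  (forall n, 0 < a n) /\ (forall n, a (S n) < a n) /\ is_lim_seq a 0.

Definition ultra (a : nat -> R) : metricfun :=
  fun x y => if excluded_middle_informative (x = y) then 0 else a (fdiff x y).

Section Ultra.
Variable a : nat -> R.
Hypothesis Ha : scale_seq a.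

Lemma scale_seq_le (m n : nat) : (m <= n)%nat -> a n <= a m.
Proof.
  induction 1 as [|n Hn IH]; [lra|]. destruct Ha as [_ [H _]]. specialize (H n). lra.
Qed.

Lemma scale_seq_le_inv (m n : nat) : a n <= a m -> (m <= n)%nat.
Proof.
  intros H. apply Nat.nlt_ge. intros Hlt. destruct Ha as [_ [Hd _]].
  specialize (Hd n). pose proof (scale_seq_le (S n) m Hlt). lra.
Qed.

Lemma ultra_refl (x : Gamma) : ultra a x x = 0.
Proof. unfold ultra. now destruct (excluded_middle_informative (x = x)). Qed.

Lemma ultra_neq (x y : Gamma) : x <> y -> ultra a x y = a (fdiff x y).
Proof. intros H. unfold ultra. now destruct (excluded_middle_informative (x = y)). Qed.

(** Closed balls of radius [a n] are exactly the cylinders of depth [n], because [a] decreases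
    strictly. The ultrametric inequality and the topology are read off from this. *)
Lemma ultra_le_iff (x y : Gamma) (n : nat) : ultra a x y <= a n <-> agree x y n.
Proof.
  destruct (classic (x = y)) as [->|Hxy].
  - rewrite ultra_refl. split; [intros _; apply agree_refl|].
    intros _. left. apply Ha.
  - rewrite (agree_le_fdiff x y n Hxy), (ultra_neq x y Hxy). split.
    + apply scale_seq_le_inv.
    + apply scale_seq_le.
Qed.

Lemma ultra_nonneg (x y : Gamma) : 0 <= ultra a x y.
Proof.
  unfold ultra. destruct (excluded_middle_informative (x = y)); [lra|].
  left. apply Ha.
Qed.

Lemma ultra_sym (x y : Gamma) : ultra a x y = ultra a y x.
Proof.
  destruct (classic (x = y)) as [->|Hxy]; [reflexivity|].
  assert (Hyx : y <> x) by congruence.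
  rewrite (ultra_neq x y Hxy), (ultra_neq y x Hyx). f_equal.
  apply Nat.le_antisymm; apply agree_le_fdiff; try assumption;
    apply agree_sym; now apply fdiff_spec.
Qed.

Lemma ultra_max (x y z : Gamma) : ultra a x z <= Rmax (ultra a x y) (ultra a y z).
Proof.
  destruct (classic (x = y)) as [->|Hxy]; [apply Rmax_r|].
  destruct (classic (y = z)) as [->|Hyz]; [apply Rmax_l|].
  rewrite (ultra_neq x y Hxy), (ultra_neq y z Hyz).
  apply Rle_trans with (a (min (fdiff x y) (fdiff y z))).
  - apply ultra_le_iff, agree_trans with y; apply agree_le_fdiff; try assumption; lia.
  - destruct (Nat.min_spec (fdiff x y) (fdiff y z)) as [[_ ->]|[_ ->]];
      [apply Rmax_l|apply Rmax_r].
Qed.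

Lemma is_metric_ultra : is_metric (ultra a).
Proof.
  repeat split.
  - apply ultra_nonneg.
  - intros H. apply NNPP. intros Hxy. rewrite (ultra_neq x y Hxy) in H.
    pose proof (proj1 Ha (fdiff x y)). lra.
  - intros ->. apply ultra_refl.
  - apply ultra_sym.
  - intros x y z. eapply Rle_trans; [apply (ultra_max x y z)|].
    pose proof (ultra_nonneg x y). pose proof (ultra_nonneg y z).
    apply Rmax_lub; lra.
Qed.

Lemma agree_small_ultra : agree_small (ultra a).
Proof.
  intros eps He. destruct (is_lim_seq_0_small a eps (proj2 (proj2 Ha)) He) as [n Hn].
  exists n. intros x y H. apply ultra_le_iff in H. lra.
Qed.

Lemma small_agree_ultra : small_agree (ultra a).
Proof.
  intros n. exists (a n). split; [apply Ha|]. intros x y H. apply ultra_le_iff. lra.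
Qed.

Lemma ultra_first_difference (x y : Gamma) (n : nat) :
  agree x y n -> dig x n <> dig y n -> ultra a x y = a n.
Proof.
  intros H Hn. assert (Hxy : x <> y) by congruence.
  rewrite (ultra_neq x y Hxy). f_equal. apply Nat.le_antisymm.
  - apply Nat.nlt_ge. intros Hlt. apply Hn.
    now apply (proj1 (fdiff_spec x y Hxy)).
  - now apply agree_le_fdiff.
Qed.
End Ultra.

(** * Doubling: finite unions and comparison with the line *)

Lemma doubling_on_union (d : metricfun) (P Q : Gamma -> Prop) :
  doubling_on d P -> doubling_on d Q -> doubling_on d (fun x => P x \/ Q x).
Proof.
  intros [k [C [HC H]]] [k' [C' [HC' H']]].
  exists (max k k'), (C + C'). split; [lra|].
  intros A D s HN HA Hs HD Hsep.
  set (f := fun x => if excluded_middle_informative (P x) then true else false).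
  assert (Hf : forall x, f x = true <-> P x).
  { intros x. unfold f. destruct (excluded_middle_informative (P x)); intuition congruence. }
  (* Both sublists inherit the bounds [D] and [s]; since [1 <= D / s], both powers can be raised to
     the larger exponent. *)
  rewrite <- (filter_length f A), plus_INR, Rmult_plus_distr_r.
  assert (H1 := Rdiv_ge_1 D s Hs).
  assert (Hpow : forall j, (j <= max k k')%nat -> (D / s) ^ j <= (D / s) ^ max k k')
    by (intros j Hj; now apply Rle_pow).
  apply Rplus_le_compat.
  - apply Rle_trans with (C * (D / s) ^ k).
    + apply H; [now apply NoDup_filter| |exact Hs| |].
      * intros x Hx. apply filter_In in Hx. now apply Hf.
      * intros x y Hx Hy. apply filter_In in Hx, Hy. now apply HD.
      * intros x y Hx Hy. apply filter_In in Hx, Hy. now apply Hsep.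
    + apply Rmult_le_compat_l; [lra|]. apply Hpow. lia.
  - apply Rle_trans with (C' * (D / s) ^ k').
    + apply H'; [now apply NoDup_filter| |exact Hs| |].
      * intros x Hx. apply filter_In in Hx. destruct Hx as [Hx Hfx].
        destruct (HA x Hx) as [HP|HQ]; [|exact HQ].
        apply Hf in HP. rewrite HP in Hfx. discriminate.
      * intros x y Hx Hy. apply filter_In in Hx, Hy. now apply HD.
      * intros x y Hx Hy. apply filter_In in Hx, Hy. now apply Hsep.
    + apply Rmult_le_compat_l; [lra|]. apply Hpow. lia.
Qed.

Lemma doubling_on_subset (d d' : metricfun) (P Q : Gamma -> Prop) :
  (forall x, Q x -> P x) -> (forall x y, Q x -> Q y -> d' x y = d x y) ->
  doubling_on d P -> doubling_on d' Q.
Proof.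
  intros HQP E [k [C [HC H]]]. exists k, C. split; [exact HC|].
  intros A D s HN HA Hs HD Hsep. apply H; auto.
  - intros x y Hx Hy. rewrite <- E by auto. auto.
  - intros x y Hx Hy. rewrite <- E by auto. auto.
Qed.

Lemma doubling_on_fibers (d : metricfun) (f : Gamma -> Gamma) (l : list Gamma) :
  (forall p, doubling_on d (fun x => f x = p)) -> doubling_on d (fun x => In (f x) l).
Proof.
  intros H. induction l as [|p l IH].
  - exists 0%nat, 1. split; [lra|]. intros A D s _ HA _ _ _.
    destruct A as [|x A]; [simpl; lra|]. destruct (HA x). now left.
  - apply (doubling_on_subset d d (fun x => f x = p \/ In (f x) l)); [|easy|].
    + intros x [Hx|Hx]; [left; now symmetry|now right].
    + now apply doubling_on_union.
Qed.

(** Pigeonhole: measured from the leftmost point in units of [s], distinct points have distinct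
    integer parts, all between 0 and the integer part of [D / s]. *)
Lemma separated_length (g : Gamma -> R) (A : list Gamma) (D s : R) :
  NoDup A -> 0 < s -> 0 <= D ->
  (forall x y, In x A -> In y A -> Rabs (g x - g y) <= D) ->
  (forall x y, In x A -> In y A -> x <> y -> s <= Rabs (g x - g y)) ->
  INR (length A) <= 1 + D / s.
Proof.
  intros HN Hs HD0 HD Hsep.
  assert (Hinv : 0 < / s) by now apply Rinv_0_lt_compat.
  assert (HDs : 0 <= D / s) by (apply Rmult_le_pos; lra).
  destruct (list_eq_dec (fun x y => excluded_middle_informative (x = y)) A nil) as [->|HA].
  { simpl. lra. }
  destruct (finite_max_exists _ (fun x => - g x) A HA) as [m [Hm Hmin]].
  assert (Hv : forall x, In x A -> 0 <= (g x - g m) / s).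
  { intros x Hx. apply Rmult_le_pos; [|lra]. specialize (Hmin x Hx). lra. }
  destruct (choice (fun x (k : nat) => In x A -> INR k <= (g x - g m) / s < INR k + 1))
    as [h Hh].
  { intros x. destruct (classic (In x A)) as [Hx|Hx].
    - destruct (nfloor_ex _ (Hv x Hx)) as [k Hk]. now exists k.
    - exists 0%nat. tauto. }
  destruct (nfloor_ex _ HDs) as [q Hq].
  assert (Hinj : NoDup (map h A)).
  { apply NoDup_map_NoDup_ForallPairs; [|exact HN].
    intros x y Hx Hy E. apply NNPP. intros Hxy.
    specialize (Hsep x y Hx Hy Hxy). assert (H1 := Hh x Hx). assert (H2 := Hh y Hy).
    rewrite E in H1.
    assert (H3 : Rabs ((g x - g y) / s) < 1).
    { replace ((g x - g y) / s) with ((g x - g m) / s - (g y - g m) / s)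
        by (field; lra). apply Rabs_lt_between. lra. }
    unfold Rdiv in H3. rewrite Rabs_mult, (Rabs_right (/ s)) in H3 by lra.
    apply (Rmult_lt_compat_r s) in H3; [|exact Hs].
    rewrite Rmult_assoc, Rinv_l in H3 by lra. lra. }
  assert (Hincl : incl (map h A) (seq 0 (S q))).
  { intros k Hk. apply in_map_iff in Hk. destruct Hk as [x [<- Hx]].
    apply in_seq. assert (H1 := Hh x Hx).
    assert (H2 : (g x - g m) / s <= D / s).
    { apply Rmult_le_compat_r; [lra|]. eapply Rle_trans; [apply Rle_abs|]. now apply HD. }
    assert (INR (h x) < INR (S q)) by (rewrite S_INR; lra).
    assert ((h x < S q)%nat) by now apply INR_lt. lia. }
  apply NoDup_incl_length in Hincl; [|exact Hinj].
  rewrite length_map, length_seq in Hincl. apply le_INR in Hincl.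
  rewrite S_INR in Hincl. lra.
Qed.

(* Distance ratios of [real_metric t] are at most [K] times those of [d], so counting
   points of the line bounds cardinalities for [d]. *)
Lemma doubling_on_embedding (t : nat -> R) (d : metricfun) (K : R) : tail_seq t ->
  0 <= K ->
  (forall D s x y x' y', 0 < s <= D -> d x y <= D -> s <= d x' y' -> x' <> y' ->
     real_metric t x y * s <= K * D * real_metric t x' y') ->
  doubling_on d (fun _ => True).
Proof.
  intros Ht HK H. exists 1%nat, (1 + K). split; [lra|].
  intros A D s HN _ Hs HD Hsep. rewrite pow_1.
  assert (H1 := Rdiv_ge_1 D s Hs).
  destruct (le_lt_dec 2 (length A)) as [Hl|Hl].
  - destruct (fin_sep_spec _ A (is_metric_real_metric t Ht) HN Hl)
      as [[x' [y' [Hx' [Hy' [Hxy' E]]]]] Hmin].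
    rewrite E in Hmin.
    assert (Hpos := metric_pos _ _ _ (is_metric_real_metric t Ht) Hxy').
    set (sg := real_metric t x' y') in *.
    apply Rle_trans with (1 + (K * (D / s) * sg) / sg).
    + apply (separated_length (fun x => tail_sum t 0 (dig x))); auto.
      * apply Rmult_le_pos; [apply Rmult_le_pos; lra|lra].
      * intros x y Hx Hy. change (real_metric t x y <= K * (D / s) * sg).
        apply Rmult_le_reg_r with s; [lra|].
        replace (K * (D / s) * sg * s) with (K * D * sg) by (field; lra).
        apply H; auto.
    + replace (K * (D / s) * sg / sg) with (K * (D / s)) by (field; lra). lra.
  - apply Rle_trans with 1; [apply (le_INR (length A) 1); lia|]. nra.
Qed.

Lemma doubling_on_real_metric (t : nat -> R) : tail_seq t ->
  doubling_on (real_metric t) (fun _ => True).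
Proof.
  intros Ht. apply (doubling_on_embedding t _ 1 Ht); [lra|].
  intros D s x y x' y' Hs HD Hsep _. rewrite Rmult_1_l.
  apply Rmult_le_compat; try lra. apply is_metric_real_metric, Ht.
Qed.

(** The comparison is with the middle-third metric, whose value at first difference [n] lies between
    [t3 n / 3] and [t3 n]; this is the origin of the factor 3. As [a] decays at least as fast as
    [t3], ratios of [t3] between levels are at most those of [a]. *)
Lemma doubling_on_ultra (a : nat -> R) : scale_seq a -> (forall n, 3 * a (S n) <= a n) ->
  doubling_on (ultra a) (fun _ => True).
Proof.
  intros Ha H3. apply (doubling_on_embedding t3 _ 3 tail_seq_t3); [lra|].
  intros D s x y x' y' Hs HD Hsep Hxy'.
  assert (Hp := proj1 tail_seq_t3).
  assert (Ht : forall n, t3 n = 3 * t3 (S n)).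
  { intros n. unfold t3. simpl. field. apply pow_nonzero. lra. }
  (* The quotient of [a] by [t3] does not increase. *)
  assert (Hdec : forall m k, a (m + k)%nat * t3 m <= a m * t3 (m + k)).
  { intros m k. induction k as [|k IH]; [rewrite Nat.add_0_r; lra|].
    rewrite Nat.add_succ_r. specialize (Ht (m + k)%nat). specialize (H3 (m + k)%nat).
    assert (3 * a (S (m + k)) * t3 m <= a (m + k)%nat * t3 m)
      by (apply Rmult_le_compat_r; [left; apply Hp|lra]).
    rewrite Ht in IH. lra. }
  rewrite (ultra_neq a x' y' Hxy') in Hsep.
  destruct (fdiff_spec x' y' Hxy') as [Hk Hk'].
  assert (Hge := tail_sum_diff_ge t3 tail_seq_t3 _ _ _ Hk Hk').
  fold (real_metric t3 x' y') in Hge. set (k := fdiff x' y') in *.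
  assert (Hge' : t3 k <= 3 * real_metric t3 x' y')
    by (specialize (Ht k); lra). clear Hge.
  assert (Hk0 := Hp k).
  destruct (classic (x = y)) as [->|Hxy].
  { unfold real_metric at 1. rewrite Rminus_diag, Rabs_R0. nra. }
  rewrite (ultra_neq a x y Hxy) in HD.
  assert (Hle := tail_sum_diff_le t3 tail_seq_t3 _ _ _ (proj1 (fdiff_spec x y Hxy))).
  fold (real_metric t3 x y) in Hle. set (m := fdiff x y) in *.
  assert (Hm0 := Hp m). pose proof (proj1 Ha m). pose proof (proj1 Ha k).
  apply Rle_trans with (D * t3 k); [|nra].
  apply Rle_trans with (t3 m * s); [apply Rmult_le_compat_r; lra|].
  destruct (le_lt_dec m k) as [Hmk|Hmk].
  - specialize (Hdec m (k - m)%nat). replace (m + (k - m))%nat with k in Hdec by lia.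
    apply Rle_trans with (t3 m * a k); [apply Rmult_le_compat_l; lra|].
    apply Rle_trans with (a m * t3 k); [lra|]. apply Rmult_le_compat_r; lra.
  - assert (t3 m <= t3 k).
    { apply Rinv_le_contravar; [apply pow_lt; lra|]. apply Rle_pow; [lra|lia]. }
    nra.
Qed.

(** Every point has a neighbour at distance exactly [b n], and bounded ratios prevent wide empty
    annuli. Flipping a late digit stays inside the cylinder, so the condition survives gluing,
    unlike one that involves the diameter of the space. *)
Definition perfect_scale (d : metricfun) : Prop :=
  exists (b : nat -> R) (kappa : R), 0 < kappa /\ (forall n, 0 < b n) /\
    is_lim_seq b 0 /\ (forall n, kappa * b n <= b (S n)) /\
    forall x n, d x (flip x n) = b n.

Lemma dig_flip_neq (x : Gamma) (n : nat) : dig x n <> dig (flip x n) n.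
Proof. unfold flip. rewrite dig_upd_eq. now destruct (dig x n). Qed.

Lemma agree_flip (x : Gamma) (m n : nat) : (m <= n)%nat -> agree x (flip x n) m.
Proof. apply agree_upd. Qed.

Lemma perfect_scale_ultra (a : nat -> R) (kappa : R) : scale_seq a -> 0 < kappa ->
  (forall n, kappa * a n <= a (S n)) -> perfect_scale (ultra a).
Proof.
  intros Ha Hk H. exists a, kappa. repeat split; try assumption; try apply Ha.
  intros x n. apply ultra_first_difference; [|apply dig_flip_neq].
  now apply agree_flip.
Qed.

Lemma perfect_scale_real_metric (t : nat -> R) (kappa : R) : tail_seq t -> 0 < kappa ->
  (forall n, kappa * t n <= t (S n)) -> perfect_scale (real_metric t).
(* The halving comes from [t (S n) - t (S (S n)) > t (S n) / 2]. *)
Proof.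
  intros Ht Hk H. exists (fun n => t n - t (S n)), (kappa / 2).
  destruct Ht as [Hp [Hg Hl]]. repeat split.
  - lra.
  - intros n. specialize (Hg n). pose proof (Hp (S n)). lra.
  - replace (Finite 0) with (Finite (0 - 0)) by (f_equal; ring).
    apply is_lim_seq_minus'; [exact Hl|]. now apply (is_lim_seq_incr_1 t).
  - intros n. specialize (H n). pose proof (Hg (S n)). pose proof (Hp (S n)). nra.
  - intros x n. apply tail_sum_diff_single; [now split| |apply dig_flip_neq].
    intros i Hi. unfold flip. now rewrite dig_upd_neq.
Qed.

(** * Model metrics *)

Definition slow_scale (n : nat) : R := / (INR n + 1).

(** Consecutive values have ratio [3 ^ (2 * n + 1)]: unbounded, which leaves ever wider empty
    annuli, but at least 3, which keeps doubling. *)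
Definition fast_scale (n : nat) : R := / 3 ^ (n * n).

(** A fat Cantor set: its [2 ^ n] intervals of level [n] have total length [1 + / (INR n + 1)],
    decreasing to 1. The gap at level [n] is [/ 2 ^ n] times the decrease of this factor. *)
Definition thin_gaps (n : nat) : R := / 2 ^ n * (1 + / (INR n + 1)).

Lemma INR_plus_pos (n : nat) (r : R) : 0 < r -> 0 < INR n + r.
Proof. intros H. pose proof (pos_INR n). lra. Qed.

Lemma scale_seq_t3 : scale_seq t3.
Proof.
  destruct tail_seq_t3 as [Hp [Hg Hl]]. repeat split; try assumption.
  intros n. specialize (Hg n). pose proof (Hp (S n)). lra.
Qed.

Lemma scale_seq_slow : scale_seq slow_scale.
Proof.
  unfold slow_scale. repeat split.
  - intros n. apply Rinv_0_lt_compat, INR_plus_pos. lra.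
  - intros n. rewrite S_INR. pose proof (pos_INR n). apply Rinv_lt_contravar; [nra|lra].
  - replace (Finite 0) with (Rbar_inv p_infty) by reflexivity.
    apply is_lim_seq_inv; [|easy].
    apply (is_lim_seq_ext (fun n => INR (S n))); [intros n; apply S_INR|].
    apply (is_lim_seq_incr_1 INR), is_lim_seq_INR.
Qed.

Lemma fast_scale_S (n : nat) : fast_scale n = 3 ^ (2 * n + 1) * fast_scale (S n).
Proof.
  unfold fast_scale. replace (S n * S n)%nat with ((2 * n + 1) + n * n)%nat by lia.
  rewrite (pow_add 3 (2 * n + 1) (n * n)). field.
  split; apply pow_nonzero; lra.
Qed.

Lemma fast_scale_pos (n : nat) : 0 < fast_scale n.
Proof. apply Rinv_0_lt_compat, pow_lt. lra. Qed.

Lemma pow3_ge (n : nat) : 3 <= 3 ^ (2 * n + 1).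
Proof.
  rewrite <- (pow_1 3) at 1. apply Rle_pow; [lra|lia].
Qed.

Lemma fast_scale_third (n : nat) : 3 * fast_scale (S n) <= fast_scale n.
Proof.
  rewrite (fast_scale_S n). apply Rmult_le_compat_r; [left; apply fast_scale_pos|].
  apply pow3_ge.
Qed.

Lemma scale_seq_fast : scale_seq fast_scale.
Proof.
  repeat split.
  - apply fast_scale_pos.
  - intros n. pose proof (fast_scale_third n). pose proof (fast_scale_pos (S n)). lra.
  - apply is_lim_seq_le_le with (fun _ => 0) t3.
    + intros n. split; [left; apply fast_scale_pos|].
      apply Rinv_le_contravar; [apply pow_lt; lra|]. apply Rle_pow; [lra|nia].
    + apply is_lim_seq_const.
    + apply tail_seq_t3.
Qed.

Lemma pow2_inv_S (n : nat) : / 2 ^ S n = / 2 ^ n / 2.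
Proof. simpl. field. apply pow_nonzero. lra. Qed.

Lemma pow2_inv_pos (n : nat) : 0 < / 2 ^ n.
Proof. apply Rinv_0_lt_compat, pow_lt. lra. Qed.

Lemma inv_INR_bounds (n : nat) : 0 < / (INR n + 1) <= 1.
Proof.
  pose proof (pos_INR n). split; [apply Rinv_0_lt_compat; lra|].
  rewrite <- Rinv_1. apply Rinv_le_contravar; lra.
Qed.

Lemma thin_gaps_bounds (n : nat) : / 2 ^ n <= thin_gaps n <= 2 * / 2 ^ n.
Proof.
  unfold thin_gaps. pose proof (pow2_inv_pos n). pose proof (inv_INR_bounds n). nra.
Qed.

Lemma thin_gaps_gap (n : nat) :
  0 < thin_gaps n - 2 * thin_gaps (S n) <= / 2 ^ n * / (INR n + 1).
Proof.
  unfold thin_gaps. rewrite pow2_inv_S. pose proof (pow2_inv_pos n).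
  pose proof (inv_INR_bounds (S n)).
  assert (/ (INR (S n) + 1) < / (INR n + 1)) by apply scale_seq_slow.
  nra.
Qed.

Lemma tail_seq_thin_gaps : tail_seq thin_gaps.
Proof.
  repeat split.
  - intros n. pose proof (thin_gaps_bounds n). pose proof (pow2_inv_pos n). lra.
  - intros n. pose proof (thin_gaps_gap n). lra.
  - apply is_lim_seq_le_le with (fun _ => 0) (fun n => 2 * (/ 2) ^ n).
    + intros n. pose proof (thin_gaps_bounds n). pose proof (pow2_inv_pos n).
      rewrite pow_inv. lra.
    + apply is_lim_seq_const.
    + replace (Finite 0) with (Rbar_mult 2 0) by (simpl; f_equal; ring).
      apply is_lim_seq_scal_l, is_lim_seq_geom. rewrite Rabs_right; lra.
Qed.

Lemma perfect_scale_t3 : perfect_scale (ultra t3).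
Proof.
  apply (perfect_scale_ultra t3 (/ 3)); [apply scale_seq_t3|lra|].
  intros n. unfold t3. simpl. rewrite Rinv_mult. lra.
Qed.

Lemma perfect_scale_slow : perfect_scale (ultra slow_scale).
Proof.
  apply (perfect_scale_ultra _ (/ 2)); [apply scale_seq_slow|lra|].
  intros n. unfold slow_scale. rewrite S_INR, <- Rinv_mult. pose proof (pos_INR n).
  apply Rinv_le_contravar; lra.
Qed.

Lemma perfect_scale_thin_gaps : perfect_scale (real_metric thin_gaps).
Proof.
  apply (perfect_scale_real_metric _ (/ 4)); [apply tail_seq_thin_gaps|lra|].
  intros n. pose proof (thin_gaps_bounds n). pose proof (thin_gaps_bounds (S n)).
  rewrite pow2_inv_S in *. lra.
Qed.

Lemma doubling_on_t3 : doubling_on (ultra t3) (fun _ => True).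
Proof.
  apply doubling_on_ultra; [apply scale_seq_t3|].
  intros n. right. unfold t3. simpl. field. apply pow_nonzero. lra.
Qed.

(** Serves twice: to list all base points for gluing, and as a large well-separated set against
    doubling. *)
Fixpoint cyl (k n : nat) (x : Gamma) : list Gamma :=
  match k with
  | O => x :: nil
  | S k => cyl k (S n) (upd x n false) ++ cyl k (S n) (upd x n true)
  end.

Lemma in_cyl (k n : nat) (x y : Gamma) :
  In y (cyl k n x) <-> agree x y n /\ forall i, (n + k <= i)%nat -> dig x i = dig y i.
Proof.
  revert n x. induction k as [|k IH]; intros n x; simpl.
  - split.
    + intros [->|[]]. split; [apply agree_refl|easy].
    + intros [H1 H2]. left. apply Gamma_ext. intros i.
      destruct (le_lt_dec n i); [apply H2; lia|now apply H1].
  - assert (Hb : forall b, In y (cyl k (S n) (upd x n b)) <->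
      (agree x y n /\ dig y n = b) /\ forall i, (n + S k <= i)%nat -> dig x i = dig y i).
    { intros b. rewrite IH. split; intros [H1 H2]; split.
      - split.
        + intros i Hi. rewrite <- (H1 i) by lia. now rewrite dig_upd_neq by lia.
        + rewrite <- (H1 n) by lia. apply dig_upd_eq.
      - intros i Hi. rewrite <- (H2 i) by lia. now rewrite dig_upd_neq by lia.
      - destruct H1 as [H1 <-]. apply agree_S; [|apply dig_upd_eq].
        intros i Hi. rewrite dig_upd_neq by lia. now apply H1.
      - intros i Hi. rewrite dig_upd_neq by lia. apply H2. lia. }
    rewrite in_app_iff, !Hb. destruct (dig y n); intuition congruence.
Qed.

Lemma NoDup_cyl (k n : nat) (x : Gamma) : NoDup (cyl k n x).
Proof.
  revert n x. induction k as [|k IH]; intros n x; simpl.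
  - constructor; [easy|constructor].
  - apply NoDup_app; try apply IH.
    intros y H1 H2. apply in_cyl in H1, H2.
    assert (E1 := proj1 H1 n (Nat.lt_succ_diag_r n)).
    assert (E2 := proj1 H2 n (Nat.lt_succ_diag_r n)).
    rewrite dig_upd_eq in E1, E2. congruence.
Qed.

Lemma length_cyl (k n : nat) (x : Gamma) : length (cyl k n x) = (2 ^ k)%nat.
Proof.
  revert n x. induction k as [|k IH]; intros n x; simpl; [reflexivity|].
  rewrite length_app, !IH. lia.
Qed.

(** The reflexive transitive closure lets chains be concatenated without index arithmetic; the
    indexed sequence is rebuilt only here. *)
Lemma chain_bound_rt (d : metricfun) (delta eta : R) (x y : Gamma) :
  chain_bound d delta -> 0 <= eta ->
  clos_refl_trans Gamma (fun x y => d x y <= eta) x y -> delta * d x y <= eta.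
Proof.
  intros H He Hxy. apply clos_rt_rtn1 in Hxy.
  assert (Hz : exists N z, z 0%nat = x /\ z N = y /\
    forall i, (i < N)%nat -> d (z i) (z (S i)) <= eta).
  { induction Hxy as [|y w Hyw _ [N [z [H0 [HN Hz]]]]].
    - exists 0%nat, (fun _ => x). repeat split. intros i Hi. lia.
    - exists (S N), (fun i => if i <=? N then z i else w). repeat split.
      + exact H0.
      + now rewrite (proj2 (Nat.leb_gt (S N) N)) by lia.
      + intros i Hi. rewrite (proj2 (Nat.leb_le i N)) by lia.
        destruct (Nat.eq_dec i N) as [->|Hne].
        * rewrite (proj2 (Nat.leb_gt (S N) N)) by lia. now rewrite HN.
        * rewrite (proj2 (Nat.leb_le (S i) N)) by lia. apply Hz. lia. }
  destruct Hz as [N [z [E0 [EN Hz]]]]. subst x y. now apply H.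
Qed.

Lemma real_metric_fill (t : nat -> R) (x : Gamma) (n : nat) : tail_seq t ->
  real_metric t (fill n false x) (fill n true x) = t n.
Proof.
  intros Ht. unfold real_metric. rewrite (tail_sum_diff t Ht n).
  - rewrite tail_sum_false, tail_sum_true; auto.
    + rewrite Rminus_0_l, Rabs_Ropp. apply Rabs_right. left. apply Ht.
    + intros i Hi. now apply dig_fill_ge.
    + intros i Hi. now apply dig_fill_ge.
  - intros i Hi. now rewrite !dig_fill_lt.
Qed.

(** The two points are the ends of the gap opened by digit [n]: the right end of the left half and
    the left end of the right half. *)
Lemma real_metric_gap (t : nat -> R) (x : Gamma) (n : nat) : tail_seq t ->
  real_metric t (fill (S n) true (upd x n false)) (fill (S n) false (upd x n true))
  = t n - 2 * t (S n).
Proof.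
  intros Ht. unfold real_metric. rewrite (tail_sum_diff t Ht n).
  - rewrite !(tail_sum_step t Ht n). unfold digit_term.
    rewrite !dig_fill_lt, !dig_upd_eq by lia.
    rewrite (tail_sum_true t Ht (S n)) by (intros i Hi; now apply dig_fill_ge).
    rewrite (tail_sum_false t (S n)) by (intros i Hi; now apply dig_fill_ge).
    rewrite Rabs_minus_sym. destruct Ht as [_ [Hg _]]. specialize (Hg n).
    rewrite Rabs_right; lra.
  - intros i Hi. rewrite !dig_fill_lt, !dig_upd_neq by lia. reflexivity.
Qed.

Lemma fill_upd (x : Gamma) (n : nat) (b : bool) : fill (S n) b (upd x n b) = fill n b x.
Proof.
  apply Gamma_ext. intros i. destruct (lt_eq_lt_dec i n) as [[Hi| ->]|Hi].
  - now rewrite !dig_fill_lt, dig_upd_neq by lia.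
  - now rewrite dig_fill_lt, dig_upd_eq, dig_fill_ge by lia.
  - now rewrite !dig_fill_ge by lia.
Qed.

(* The cylinder of [x] is crossed by hopping over its gaps and its subcylinders of
   depth [n + k]. *)
Lemma fill_chain (t : nat -> R) (d : metricfun) (eta : R) (k n : nat) (x : Gamma) :
  tail_seq t ->
  (forall y z, agree x y n -> agree x z n -> d y z = real_metric t y z) ->
  (forall m, (n <= m)%nat -> t m - 2 * t (S m) <= eta) -> t (n + k)%nat <= eta ->
  clos_refl_trans Gamma (fun x y => d x y <= eta) (fill n false x) (fill n true x).
Proof.
  intros Ht. revert n x. induction k as [|k IH]; intros n x Hd Hg Hk.
  - apply rt_step. rewrite Hd by apply agree_fill.
    rewrite real_metric_fill by exact Ht. now rewrite Nat.add_0_r in Hk.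
  - assert (Hb : forall b, agree x (upd x n b) n) by (intros b; now apply agree_upd).
    assert (Hf : forall b c, agree x (fill (S n) c (upd x n b)) n).
    { intros b c. apply agree_trans with (1 := Hb b).
      apply agree_le with (S n); [lia|apply agree_fill]. }
    assert (Hc : forall b, clos_refl_trans Gamma (fun x y => d x y <= eta)
      (fill (S n) false (upd x n b)) (fill (S n) true (upd x n b))).
    { intros b. apply IH.
      - intros y z Hy Hz. apply Hd; apply agree_trans with (1 := Hb b);
          (apply agree_le with (S n); [lia|assumption]).
      - intros m Hm. apply Hg. lia.
      - now rewrite Nat.add_succ_l, <- Nat.add_succ_r. }
    rewrite <- (fill_upd x n false), <- (fill_upd x n true).
    eapply rt_trans; [apply Hc|]. eapply rt_trans; [|apply Hc].
    apply rt_step. rewrite Hd by apply Hf. rewrite real_metric_gap by exact Ht.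
    apply Hg. lia.
Qed.

(** * Gluing metrics on cylinders *)

Section Glue.
Variable d : metricfun.
(* The metric used on a cylinder depends on its first two digits only. *)
Variable M : bool -> bool -> metricfun.
Variable n : nat.
Variable eps : R.
Hypothesis Hd : is_metric d.
Hypothesis HM : forall b c, is_metric (M b c).
Hypothesis Hn : (2 <= n)%nat.
Hypothesis Hdsmall : forall x y, agree x y n -> d x y < eps.
Hypothesis HMsmall : forall b c x y, agree x y n -> M b c x y < eps.

Let Mx (x : Gamma) : metricfun := M (dig x 0) (dig x 1).
Let P (x : Gamma) : Gamma := fill n false x.

(** Passing between cylinders is forced through their base points, so the triangle inequality
    reduces to those of [d] and of the models. *)
Definition glue : metricfun := fun x y =>
  if excluded_middle_informative (agree x y n) then Mx x x y
  else Mx x x (P x) + d (P x) (P y) + Mx y y (P y).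

Lemma Mx_agree (x y : Gamma) : agree x y n -> Mx x = Mx y.
Proof. intros H. unfold Mx. rewrite (H 0%nat), (H 1%nat) by lia. reflexivity. Qed.

Lemma P_agree (x y : Gamma) : agree x y n -> P x = P y.
Proof. apply fill_eq_iff. Qed.

Lemma glue_in (x y : Gamma) : agree x y n -> glue x y = M (dig x 0) (dig x 1) x y.
Proof.
  intros H. unfold glue. now destruct (excluded_middle_informative (agree x y n)).
Qed.

Lemma glue_out (x y : Gamma) : ~ agree x y n ->
  glue x y = Mx x x (P x) + d (P x) (P y) + Mx y y (P y).
Proof.
  intros H. unfold glue. now destruct (excluded_middle_informative (agree x y n)).
Qed.

Lemma Mx_P_bounds (x : Gamma) : 0 <= Mx x x (P x) < eps.
Proof. split; [apply HM|]. apply HMsmall, agree_fill. Qed.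

Lemma glue_nonneg (x y : Gamma) : 0 <= glue x y.
Proof.
  destruct (classic (agree x y n)) as [H|H].
  - rewrite glue_in by exact H. apply HM.
  - rewrite glue_out by exact H. pose proof (Mx_P_bounds x). pose proof (Mx_P_bounds y).
    pose proof (proj1 Hd (P x) (P y)). lra.
Qed.

Lemma is_metric_glue : is_metric glue.
Proof.
  assert (HMt : forall x, is_metric (Mx x)) by (intros x; apply HM).
  assert (Hsym : forall x y, glue x y = glue y x).
  { intros x y. destruct (classic (agree x y n)) as [H|H].
    - assert (H' := agree_sym _ _ _ H). rewrite !glue_in by assumption.
      fold (Mx x) (Mx y). rewrite (Mx_agree x y H). apply HMt.
    - assert (H' : ~ agree y x n) by (intros H'; now apply H, agree_sym).
      rewrite !glue_out by assumption.
      rewrite (proj1 (proj2 (proj2 Hd)) (P x) (P y)). ring. }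
  split; [exact glue_nonneg|]. split; [|split; [exact Hsym|]].
  - intros x y. split.
    + intros E. destruct (classic (agree x y n)) as [H|H].
      * rewrite glue_in in E by exact H. now apply HM in E.
      * rewrite glue_out in E by exact H.
        assert (Hne : P x <> P y) by (intros E'; apply H; now apply fill_eq_iff in E').
        apply (metric_pos d _ _ Hd) in Hne.
        pose proof (Mx_P_bounds x). pose proof (Mx_P_bounds y). lra.
    + intros ->. rewrite glue_in by apply agree_refl. now apply HM.
  - intros x y z.
    assert (HMsym : forall w a b, Mx w a b = Mx w b a) by (intros w; apply HMt).
    assert (HMtri : forall w a b c, Mx w a c <= Mx w a b + Mx w b c)
      by (intros w; apply HMt).
    pose proof (Mx_P_bounds x). pose proof (Mx_P_bounds y). pose proof (Mx_P_bounds z).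
    pose proof (proj1 Hd (P x) (P y)). pose proof (proj1 Hd (P y) (P z)).
    destruct (classic (agree x y n)) as [Hxy|Hxy];
      destruct (classic (agree y z n)) as [Hyz|Hyz].
    + assert (Hxz := agree_trans _ _ _ _ Hxy Hyz).
      rewrite !glue_in by assumption. fold (Mx x) (Mx y).
      rewrite (Mx_agree x y Hxy). apply HMtri.
    + assert (Hxz : ~ agree x z n)
        by (intros H'; apply Hyz, agree_trans with x; [now apply agree_sym|exact H']).
      rewrite (glue_in x y), !glue_out by assumption. fold (Mx x).
      rewrite (Mx_agree x y Hxy), (P_agree x y Hxy).
      specialize (HMtri y x y (P y)). lra.
    + assert (Hxz : ~ agree x z n)
        by (intros H'; apply Hxy, agree_trans with z; [exact H'|now apply agree_sym]).
      rewrite (glue_in y z), !glue_out by assumption. fold (Mx y).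
      rewrite (Mx_agree y z Hyz), (P_agree y z Hyz).
      specialize (HMtri z z y (P z)). rewrite (HMsym z z y) in HMtri. lra.
    + rewrite (glue_out x y), (glue_out y z) by assumption.
      destruct (classic (agree x z n)) as [Hxz|Hxz].
      (* A detour through another cylinder passes twice through the base point of [x], which alone
         costs at least the distance inside the model. *)
      * rewrite glue_in by assumption. fold (Mx x).
        specialize (HMtri x x (P x) z). rewrite (HMsym x (P x) z) in HMtri.
        rewrite (Mx_agree x z Hxz), (P_agree x z Hxz) in *. lra.
      * rewrite glue_out by assumption.
        pose proof (proj2 (proj2 (proj2 Hd)) (P x) (P y) (P z)). lra.
Qed.

(** Across cylinders, two model distances to base points and two displacements under [d] each
    contribute at most [eps]. *)
Lemma glue_close (x y : Gamma) : Rabs (d x y - glue x y) <= 4 * eps.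
Proof.
  apply Rabs_le_between. destruct Hd as [Hd0 [_ [Hds Hdt]]].
  destruct (classic (agree x y n)) as [H|H].
  - rewrite glue_in by exact H. pose proof (Hdsmall x y H). pose proof (Hd0 x y).
    pose proof (HMsmall (dig x 0) (dig x 1) x y H).
    pose proof (proj1 (HM (dig x 0) (dig x 1)) x y). lra.
  - rewrite glue_out by exact H.
    pose proof (Mx_P_bounds x). pose proof (Mx_P_bounds y).
    assert (Hx := Hdsmall x (P x) (agree_fill x n false)).
    assert (Hy := Hdsmall y (P y) (agree_fill y n false)).
    pose proof (Hdt x (P x) y). pose proof (Hdt (P x) (P y) y).
    pose proof (Hdt (P x) x (P y)). pose proof (Hdt x y (P y)).
    rewrite (Hds (P x) x), (Hds (P y) y) in *. lra.
Qed.

Let L : list Gamma := cyl n 0 (gam (fun _ => false)).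

Lemma P_in_L (x : Gamma) : In (P x) L.
Proof.
  apply in_cyl. split; [intros i Hi; lia|].
  intros i Hi. unfold P. now rewrite dig_gam, dig_fill_ge by lia.
Qed.

Lemma length_L : (2 <= length L)%nat.
Proof.
  unfold L. rewrite length_cyl. change 2%nat with (2 ^ 1)%nat at 1.
  apply Nat.pow_le_mono_r; lia.
Qed.

(** Points in distinct cylinders are at least as far apart as their base points, of which there are
    finitely many. *)
Lemma glue_gap : exists g, 0 < g /\ forall x y, ~ agree x y n -> g <= glue x y.
Proof.
  destruct (fin_sep_spec d L Hd (NoDup_cyl _ _ _) length_L)
    as [[p [q [_ [_ [Hpq E]]]]] Hmin].
  exists (fin_sep d L). split.
  - rewrite E. now apply metric_pos.
  - intros x y H. rewrite glue_out by exact H.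
    assert (Hne : P x <> P y) by (intros E'; apply H; now apply fill_eq_iff in E').
    specialize (Hmin (P x) (P y) (P_in_L x) (P_in_L y) Hne).
    pose proof (Mx_P_bounds x). pose proof (Mx_P_bounds y). lra.
Qed.

Lemma glue_bounded : exists B, 0 < B /\ forall x y, glue x y <= B.
Proof.
  destruct (fin_diam_spec d L) as [H _].
  { pose proof length_L as H. destruct L; [simpl in H; lia|easy]. }
  set (x0 := gam (fun _ => false)).
  pose proof (H (P x0) (P x0) (P_in_L x0) (P_in_L x0)).
  pose proof (proj1 Hd (P x0) (P x0)). pose proof (Mx_P_bounds x0).
  exists (fin_diam d L + 2 * eps). split; [lra|].
  intros x y. destruct (classic (agree x y n)) as [Hxy|Hxy].
  - rewrite glue_in by exact Hxy. pose proof (HMsmall (dig x 0) (dig x 1) x y Hxy). lra.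
  - rewrite glue_out by exact Hxy.
    specialize (H (P x) (P y) (P_in_L x) (P_in_L y)).
    pose proof (Mx_P_bounds x). pose proof (Mx_P_bounds y). lra.
Qed.

Lemma Met_glue : (forall b c, agree_small (M b c)) -> (forall b c, small_agree (M b c)) ->
  Met glue.
Proof.
  intros H1 H2. apply Met_of_agree; [apply is_metric_glue| |].
  - intros r Hr.
    destruct (H1 true true r Hr) as [n1 Hn1]. destruct (H1 true false r Hr) as [n2 Hn2].
    destruct (H1 false true r Hr) as [n3 Hn3]. destruct (H1 false false r Hr) as [n4 Hn4].
    exists (n + n1 + n2 + n3 + n4)%nat. intros x y Hxy.
    rewrite glue_in by (apply agree_le with (2 := Hxy); lia).
    destruct (dig x 0), (dig x 1);
      [apply Hn1|apply Hn2|apply Hn3|apply Hn4]; apply agree_le with (2 := Hxy); lia.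
  - intros m. destruct glue_gap as [g [Hg Hgap]].
    assert (Hin : forall x y, glue x y < g -> glue x y = M (dig x 0) (dig x 1) x y).
    { intros x y H. apply glue_in, NNPP. intros Hno.
      specialize (Hgap x y Hno). lra. }
    destruct (H2 true true m) as [r1 [Hr1 Hm1]]. destruct (H2 true false m) as [r2 [Hr2 Hm2]].
    destruct (H2 false true m) as [r3 [Hr3 Hm3]]. destruct (H2 false false m) as [r4 [Hr4 Hm4]].
    exists (Rmin g (Rmin (Rmin r1 r2) (Rmin r3 r4))).
    split; [repeat apply Rmin_pos; assumption|].
    intros x y Hxy. apply Rmin_Rgt_l in Hxy. destruct Hxy as [Hxy1 Hxy2].
    apply Rmin_Rgt_l in Hxy2. destruct Hxy2 as [Ha Hb].
    apply Rmin_Rgt_l in Ha, Hb. destruct Ha as [Ha1 Ha2], Hb as [Hb1 Hb2].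
    rewrite (Hin x y Hxy1) in *. destruct (dig x 0), (dig x 1); auto.
Qed.

(** * Properties inherited from the models *)

Lemma doubling_glue : (forall b c, doubling_on (M b c) (fun _ => True)) -> doubling glue.
Proof.
  intros H. apply (doubling_iff _ is_metric_glue).
  apply (doubling_on_subset glue glue (fun x => In (P x) L)); [|easy|].
  - intros x _. apply P_in_L.
  - apply doubling_on_fibers. intros p.
    apply (doubling_on_subset (M (dig p 0) (dig p 1)) glue (fun _ => True)); auto.
    intros x y Hx Hy. unfold P in Hx, Hy.
    rewrite glue_in by (apply (fill_eq_iff x y n false); congruence).
    subst p. now rewrite !dig_fill_lt by lia.
Qed.

(** A chain with steps below the gap [g] never leaves its cylinder, where the ultrametric inequality
    bounds its span by [eta]. Otherwise [g <= eta], and the bound [B] on all distances makes any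
    constant up to [g / B] work. *)
Lemma unif_disconnected_glue :
  (forall b c x y z, M b c x z <= Rmax (M b c x y) (M b c y z)) -> unif_disconnected glue.
Proof.
  intros H. apply (unif_disconnected_iff _ is_metric_glue).
  destruct glue_gap as [g [Hg Hgap]]. destruct glue_bounded as [B [HB HBound]].
  exists (Rmin (/ 2) (g / B)). assert (HgB : 0 < g / B) by now apply Rdiv_lt_0_compat.
  assert (Hl := Rmin_l (/ 2) (g / B)). assert (Hr := Rmin_r (/ 2) (g / B)).
  assert (Hpos : 0 < Rmin (/ 2) (g / B)) by (apply Rmin_pos; lra).
  set (delta := Rmin (/ 2) (g / B)) in *.
  split; [lra|]. intros N z eta He Hz.
  destruct (Rlt_le_dec eta g) as [Hlt|Hge].
  - assert (HN : forall k, (k <= N)%nat -> agree (z 0%nat) (z k) n /\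
      glue (z 0%nat) (z k) <= eta).
    { induction k as [|k IH]; intros Hk.
      - split; [apply agree_refl|]. rewrite glue_in by apply agree_refl.
        now rewrite (proj2 (proj1 (proj2 (HM _ _)) _ _) eq_refl).
      - destruct IH as [Ha Hle]; [lia|]. specialize (Hz k ltac:(lia)).
        assert (Hak : agree (z k) (z (S k)) n).
        { apply NNPP. intros Hno. specialize (Hgap _ _ Hno). lra. }
        assert (Ha' := agree_trans _ _ _ _ Ha Hak). split; [exact Ha'|].
        rewrite glue_in in * by assumption.
        rewrite <- (Ha 0%nat), <- (Ha 1%nat) in Hz by lia.
        eapply Rle_trans; [apply (H _ _ _ (z k))|]. now apply Rmax_lub. }
    destruct (HN N (Nat.le_refl N)) as [_ Hle].
    pose proof (glue_nonneg (z 0%nat) (z N)). nra.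
  - specialize (HBound (z 0%nat) (z N)). pose proof (glue_nonneg (z 0%nat) (z N)).
    apply Rle_trans with (g / B * B).
    + apply Rmult_le_compat; lra.
    + unfold Rdiv. rewrite Rmult_assoc, Rinv_l; lra.
Qed.

(** As [b] tends to 0, it crosses [r] at some step: [r <= b m] and [b (S m) < r]. Flipping digit
    [S m] then gives a distance that is less than [r] and at least [kappa * r]. *)
Lemma perfect_scale_point (e : metricfun) (b : nat -> R) (kappa r : R) (x : Gamma) :
  0 < kappa -> is_lim_seq b 0 -> (forall n, 0 < b n) ->
  (forall m, kappa * b m <= b (S m)) ->
  (forall m, (n <= m)%nat -> e x (flip x m) = b m) ->
  0 < r <= b n -> exists y, kappa * r <= e x y <= r.
Proof.
  intros Hk Hl Hp Hb He Hr.
  assert (Hm : exists m, (n <= m)%nat /\ r <= b m /\ b (S m) < r).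
  { apply NNPP. intros Hno.
    assert (Hall : forall k, r <= b (k + n)%nat).
    { induction k as [|k IH]; [apply Hr|]. apply Rnot_lt_le. intros Hlt.
      apply Hno. exists (k + n)%nat. repeat split; [lia|exact IH|exact Hlt]. }
    apply (is_lim_seq_incr_n b n) in Hl.
    destruct (is_lim_seq_0_small _ r Hl) as [k Hk']; [lra|]. specialize (Hall k). lra. }
  destruct Hm as [m [Hnm [H1 H2]]]. exists (flip x (S m)).
  rewrite He by lia. specialize (Hb m). split; [|lra].
  apply Rle_trans with (kappa * b m); [|exact Hb]. apply Rmult_le_compat_l; lra.
Qed.

Lemma unif_perfect_glue : (forall b c, perfect_scale (M b c)) -> unif_perfect glue.
Proof.
  intros H.
  assert (Hloc : exists kappa r0, 0 < kappa < 1 /\ 0 < r0 /\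
    forall x r, 0 < r <= r0 -> exists y, kappa * r <= glue x y <= r).
  { assert (Hbc : forall b c, exists kappa r0, 0 < kappa < 1 /\ 0 < r0 /\
      forall x r, dig x 0 = b -> dig x 1 = c -> 0 < r <= r0 ->
        exists y, kappa * r <= glue x y <= r).
    { intros b c. destruct (H b c) as [s [kappa [Hk [Hp [Hl [Hs Hf]]]]]].
      assert (Hk2 := Rmin_l kappa (/ 2)). assert (Hk3 := Rmin_r kappa (/ 2)).
      exists (Rmin kappa (/ 2)), (s n).
      split; [split; [apply Rmin_pos|]; lra|]. split; [apply Hp|].
      intros x r Hx0 Hx1 Hr.
      destruct (perfect_scale_point glue s kappa r x) as [y Hy]; auto.
      - intros m Hm. rewrite glue_in by now apply agree_flip.
        rewrite Hx0, Hx1. apply Hf.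
      - exists y. split; [|lra]. apply Rle_trans with (kappa * r); [|lra].
        apply Rmult_le_compat_r; lra. }
    (* Local constants for two sets of centres combine by minima, which merges the four models. *)
    assert (Hmin : forall Q1 Q2 : Gamma -> Prop,
      (exists kappa r0, 0 < kappa < 1 /\ 0 < r0 /\
        forall x r, Q1 x -> 0 < r <= r0 -> exists y, kappa * r <= glue x y <= r) ->
      (exists kappa r0, 0 < kappa < 1 /\ 0 < r0 /\
        forall x r, Q2 x -> 0 < r <= r0 -> exists y, kappa * r <= glue x y <= r) ->
      exists kappa r0, 0 < kappa < 1 /\ 0 < r0 /\
        forall x r, Q1 x \/ Q2 x -> 0 < r <= r0 -> exists y, kappa * r <= glue x y <= r).
    { intros Q1 Q2 [k1 [r1 [Hk1 [Hr1 H1]]]] [k2 [r2 [Hk2 [Hr2 H2]]]].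
      assert (A1 := Rmin_l k1 k2). assert (A2 := Rmin_r k1 k2).
      assert (A3 := Rmin_l r1 r2). assert (A4 := Rmin_r r1 r2).
      exists (Rmin k1 k2), (Rmin r1 r2).
      split; [split; [apply Rmin_pos|]; lra|]. split; [now apply Rmin_pos|].
      intros x r [Hx|Hx] Hr.
      - destruct (H1 x r Hx) as [y Hy]; [lra|]. exists y. split; [|lra].
        apply Rle_trans with (k1 * r); [apply Rmult_le_compat_r|]; lra.
      - destruct (H2 x r Hx) as [y Hy]; [lra|]. exists y. split; [|lra].
        apply Rle_trans with (k2 * r); [apply Rmult_le_compat_r|]; lra. }
    assert (Hall : forall b c, exists kappa r0, 0 < kappa < 1 /\ 0 < r0 /\
      forall x r, dig x 0 = b /\ dig x 1 = c -> 0 < r <= r0 ->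
        exists y, kappa * r <= glue x y <= r).
    { intros b c. destruct (Hbc b c) as [k [r0 [A1 [A2 A3]]]].
      exists k, r0. repeat split; try lra. intros x r [Hx0 Hx1]. now apply A3. }
    destruct (Hmin _ _ (Hmin _ _ (Hall true true) (Hall true false))
      (Hmin _ _ (Hall false true) (Hall false false))) as [k [r0 [A1 [A2 A3]]]].
    exists k, r0. repeat split; try lra. intros x r. apply A3.
    destruct (dig x 0), (dig x 1); tauto. }
  destruct Hloc as [kappa [r0 [Hk [Hr0 Hloc]]]].
  destruct glue_bounded as [B [HB HBound]].
  set (B' := Rmax B r0). assert (HB1 : B <= B') by apply Rmax_l.
  assert (HB2 : r0 <= B') by apply Rmax_r.
  assert (Hq : 0 < r0 / B' <= 1).
  { split; [apply Rdiv_lt_0_compat; lra|].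
    apply Rmult_le_reg_r with B'; [lra|].
    unfold Rdiv. rewrite Rmult_assoc, Rinv_l; lra. }
  (* Radii up to the diameter are shrunk by [r0 / B'] into the range of the local statement; the
     maximum in [B'] keeps this factor at most 1. *)
  exists (kappa * (r0 / B')). split; [nra|].
  intros x r Hr Hdiam. apply diam_space_gt_iff in Hdiam. destruct Hdiam as [a [b Hab]].
  specialize (HBound a b).
  assert (Hrr : 0 < r0 / B' * r) by (apply Rmult_lt_0_compat; lra).
  destruct (Hloc x (r0 / B' * r)) as [y Hy].
  - split; [exact Hrr|]. replace r0 with (r0 / B' * B') at 2 by (field; lra).
    apply Rmult_le_compat_l; lra.
  - exists y. split; [lra|]. nra.
Qed.

(** * Properties spoiled by a single model *)

Let pt (b c : bool) : Gamma := gam (fun i => if i =? 0 then b else c).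

Lemma glue_near (b c : bool) (x y : Gamma) : agree (pt b c) x n -> agree (pt b c) y n ->
  glue x y = M b c x y.
Proof.
  intros Hx Hy. rewrite glue_in by
    (apply agree_trans with (pt b c); [now apply agree_sym|exact Hy]).
  rewrite <- (Hx 0%nat), <- (Hx 1%nat) by lia. unfold pt. now rewrite !dig_gam.
Qed.

(** Between levels [m] and [2 * m] there are [2 ^ m] points, while the scale shrinks by a factor
    below 2. Doubling would bound [2 ^ m] by the fixed number [C * 2 ^ k]. *)
Lemma not_doubling_glue (b c : bool) : M b c = ultra slow_scale -> ~ doubling glue.
Proof.
  intros E Hdbl. apply (doubling_iff _ is_metric_glue) in Hdbl.
  destruct Hdbl as [k [C [HC H]]].
  destruct (exists_nat_ge (C * 2 ^ k)) as [m0 Hm0].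
  set (m := max n m0).
  assert (Hin : forall x, In x (cyl m m (pt b c)) -> agree (pt b c) x n).
  { intros x Hx. apply in_cyl in Hx. apply agree_le with (2 := proj1 Hx). lia. }
  assert (Hm := pos_INR m).
  assert (HS : INR (m + m) = INR m + INR m) by apply plus_INR.
  assert (Hs : 0 < slow_scale (m + m) <= slow_scale m).
  { split; [apply scale_seq_slow|]. apply scale_seq_le; [apply scale_seq_slow|lia]. }
  assert (Hlen : INR (length (cyl m m (pt b c))) <=
    C * (slow_scale m / slow_scale (m + m)) ^ k).
  { apply H; auto.
    - apply NoDup_cyl.
    - intros x y Hx Hy. rewrite (glue_near b c x y), E by auto.
      apply ultra_le_iff; [apply scale_seq_slow|]. apply in_cyl in Hx, Hy.
      apply agree_trans with (pt b c); [now apply agree_sym|apply Hy].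
    - intros x y Hx Hy Hxy. rewrite (glue_near b c x y), E by auto.
      apply Rnot_lt_le. intros Hlt. apply Rlt_le in Hlt.
      apply ultra_le_iff in Hlt; [|apply scale_seq_slow]. apply Hxy, Gamma_ext. intros i.
      destruct (le_lt_dec (m + m) i) as [Hi|Hi]; [|now apply Hlt].
      apply in_cyl in Hx, Hy. now rewrite <- (proj2 Hx), <- (proj2 Hy). }
  rewrite length_cyl, pow_INR in Hlen. change (INR 2) with 2 in Hlen.
  assert (Hq : slow_scale m / slow_scale (m + m) <= 2).
  { unfold slow_scale. rewrite HS.
    replace (/ (INR m + 1) / / (INR m + INR m + 1))
      with (2 - / (INR m + 1)) by (field; lra).
    pose proof (inv_INR_bounds m). lra. }
  assert (Hq0 : 0 <= slow_scale m / slow_scale (m + m))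
    by (left; apply Rdiv_lt_0_compat; lra).
  assert (Hpow : (slow_scale m / slow_scale (m + m)) ^ k <= 2 ^ k)
    by (apply pow_incr; lra).
  assert (Hlin : INR m < 2 ^ m).
  { change 2 with (INR 2). rewrite <- pow_INR. apply lt_INR, Nat.pow_gt_lin_r. lia. }
  assert (INR m0 <= INR m) by (apply le_INR; lia).
  assert (C * (slow_scale m / slow_scale (m + m)) ^ k <= C * 2 ^ k)
    by (apply Rmult_le_compat_l; lra).
  lra.
Qed.

(** A cylinder of depth [m] has length at least [/ 2 ^ m] but is crossed by steps of at most
    [/ 2 ^ m * / (INR m + 1)], which forces [delta <= / (INR m + 1)]. *)
Lemma not_unif_disconnected_glue (b c : bool) : M b c = real_metric thin_gaps ->
  ~ unif_disconnected glue.
Proof.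
  intros E Hud. apply (unif_disconnected_iff _ is_metric_glue) in Hud.
  destruct Hud as [delta [Hdelta H]].
  destruct (exists_nat_ge (/ delta)) as [m0 Hm0].
  set (m := max n m0).
  assert (Ht := tail_seq_thin_gaps).
  assert (Hp := pow2_inv_pos m). assert (Hi := inv_INR_bounds m).
  assert (Hm := pos_INR m).
  assert (Hnear : forall x, agree (pt b c) x m -> agree (pt b c) x n)
    by (intros x; apply agree_le; lia).
  assert (Hc : delta * glue (fill m false (pt b c)) (fill m true (pt b c))
    <= / 2 ^ m * / (INR m + 1)).
  { apply chain_bound_rt; [exact H|nra|].
    (* Going [S m] levels deeper makes the subcylinders no longer than [/ 2 ^ m * / 2 ^ m], and
       [2 ^ m] is at least [m + 1]. *)
    apply (fill_chain thin_gaps glue _ (S m)); [exact Ht| | |].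
    - intros y z Hy Hz. rewrite <- E. apply glue_near; auto.
    - intros j Hj. pose proof (thin_gaps_gap j).
      assert (/ 2 ^ j <= / 2 ^ m).
      { apply Rinv_le_contravar; [apply pow_lt; lra|]. apply Rle_pow; [lra|lia]. }
      assert (/ (INR j + 1) <= / (INR m + 1)).
      { apply Rinv_le_contravar; [lra|]. apply le_INR in Hj. lra. }
      pose proof (pow2_inv_pos j). pose proof (inv_INR_bounds j).
      apply Rle_trans with (/ 2 ^ j * / (INR j + 1)); [lra|].
      apply Rmult_le_compat; lra.
    - pose proof (thin_gaps_bounds (m + S m)). rewrite pow_add, Rinv_mult, pow2_inv_S in *.
      assert (/ 2 ^ m <= / (INR m + 1)).
      { apply Rinv_le_contravar; [lra|]. rewrite <- S_INR.
        change 2 with (INR 2). rewrite <- pow_INR. apply le_INR.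
        assert ((m < 2 ^ m)%nat) by (apply Nat.pow_gt_lin_r; lia). lia. }
      nra. }
  rewrite (glue_near b c), E, real_metric_fill in Hc by (auto using agree_fill).
  pose proof (thin_gaps_bounds m).
  assert (Hd1 : delta * / 2 ^ m <= / 2 ^ m * / (INR m + 1)) by nra.
  rewrite Rmult_comm in Hd1. apply Rmult_le_reg_l in Hd1; [|exact Hp].
  assert (INR m0 <= INR m) by (apply le_INR; lia).
  assert (/ (INR m + 1) < / / delta).
  { apply Rinv_lt_contravar; [|lra]. apply Rmult_lt_0_compat; [|lra].
    apply Rinv_0_lt_compat; lra. }
  rewrite Rinv_inv in *. lra.
Qed.

(** Below the gap between cylinders the only distances from [x] are values of [fast_scale]. At
    radius [fast_scale m / 2] the next available one is [fast_scale (S m)], too small for [kappa]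
    once [m] is large. *)
Lemma not_unif_perfect_glue (b c : bool) : M b c = ultra fast_scale -> ~ unif_perfect glue.
Proof.
  intros E [kappa [Hk H]].
  destruct glue_gap as [g [Hg Hgap]].
  destruct (is_lim_seq_0_small fast_scale g (proj2 (proj2 scale_seq_fast)) Hg) as [m1 Hm1].
  destruct (exists_nat_ge (2 / kappa)) as [m0 Hm0].
  (* The summand [n] keeps level [m] inside the cylinder and makes [m0 < m] strict, [m0] beats
     [kappa], and [m1] brings the scale below the gap [g]. *)
  set (m := (n + m0 + m1)%nat). set (x := pt b c).
  assert (Ha := fast_scale_pos m).
  assert (Hag : fast_scale m < g).
  { eapply Rle_lt_trans; [|exact Hm1]. apply scale_seq_le; [apply scale_seq_fast|lia]. }
  destruct (H x (fast_scale m / 2)) as [y Hy]; [lra| |].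
  - apply diam_space_gt_iff. exists x, (flip x m).
    assert (Hxm : agree x (flip x m) m) by now apply agree_flip.
    rewrite (glue_near b c), E.
    + rewrite (ultra_first_difference _ x (flip x m) m Hxm (dig_flip_neq x m)). lra.
    + apply agree_refl.
    + apply agree_le with (2 := Hxm). lia.
  - assert (Hxy : agree x y n).
    { apply NNPP. intros Hno. specialize (Hgap x y Hno). lra. }
    rewrite (glue_near b c), E in Hy by (auto using agree_refl).
    assert (Hne : x <> y).
    { intros <-. rewrite ultra_refl in Hy. nra. }
    assert (Hfd : (S m <= fdiff x y)%nat).
    { rewrite (ultra_neq _ x y Hne) in Hy.
      apply Nat.nle_gt. intros Hle.
      apply (scale_seq_le _ scale_seq_fast) in Hle. lra. }
    apply (agree_le_fdiff x y (S m) Hne) in Hfd.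
    apply (ultra_le_iff _ scale_seq_fast) in Hfd.
    assert (Hpow : INR m <= 3 ^ (2 * m + 1)).
    { replace 3 with (INR 3) by (simpl; ring). rewrite <- pow_INR. apply le_INR.
      assert ((2 * m + 1 < 3 ^ (2 * m + 1))%nat) by (apply Nat.pow_gt_lin_r; lia). lia. }
    assert (Hs := fast_scale_S m). assert (Hp := fast_scale_pos (S m)).
    assert (Hlt : 2 / kappa < 3 ^ (2 * m + 1)).
    { apply Rle_lt_trans with (INR m0); [exact Hm0|].
      apply Rlt_le_trans with (INR m); [|exact Hpow]. apply lt_INR. lia. }
    apply (Rmult_lt_compat_l kappa) in Hlt; [|lra].
    replace (kappa * (2 / kappa)) with 2 in Hlt by (field; lra).
    rewrite Hs in Hy. nra.
Qed.
End Glue.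

(** * Density of every type *)

(* Digits [true, false] mark the cylinders spoiling doubling, [false, true] those spoiling
   uniform disconnectedness, [true, true] those spoiling uniform perfectness. *)
Definition model (u v w b c : bool) : metricfun :=
  match b, c with
  | true, false => if u then ultra t3 else ultra slow_scale
  | false, true => if v then ultra t3 else real_metric thin_gaps
  | true, true => if w then ultra t3 else ultra fast_scale
  | false, false => ultra t3
  end.

Lemma model_ind (Q : metricfun -> Prop) (u v w : bool) : Q (ultra t3) ->
  (u = false -> Q (ultra slow_scale)) -> (v = false -> Q (real_metric thin_gaps)) ->
  (w = false -> Q (ultra fast_scale)) -> forall b c, Q (model u v w b c).
Proof.
  intros H0 H1 H2 H3 b c. destruct b, c; simpl; try exact H0;
    destruct u, v, w; auto.
Qed.

Lemma met_dense_Etype (u v w : bool) : met_dense (Etype u v w).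
Proof.
  intros d Hd r Hr.
  assert (Hs3 := scale_seq_t3). assert (Hss := scale_seq_slow).
  assert (Hsf := scale_seq_fast). assert (Htt := tail_seq_thin_gaps).
  assert (HM : forall b c, is_metric (model u v w b c)).
  { apply model_ind; intros; try now apply is_metric_ultra. now apply is_metric_real_metric. }
  assert (HMa : forall b c, agree_small (model u v w b c)).
  { apply model_ind; intros; try now apply agree_small_ultra.
    now apply agree_small_real_metric. }
  assert (HMs : forall b c, small_agree (model u v w b c)).
  { apply model_ind; intros; try now apply small_agree_ultra.
    now apply small_agree_real_metric. }
  (* Gluing moves [d] by at most [4 * eps = r / 2]. *)
  set (eps := r / 8). assert (Heps : 0 < eps) by (unfold eps; lra).
  destruct (Met_agree_small d Hd eps Heps) as [n0 Hn0].
  assert (Hn : exists n, (2 <= n)%nat /\ (forall x y, agree x y n -> d x y < eps) /\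
    forall b c x y, agree x y n -> model u v w b c x y < eps).
  { destruct (HMa true true eps Heps) as [n1 Hn1].
    destruct (HMa true false eps Heps) as [n2 Hn2].
    destruct (HMa false true eps Heps) as [n3 Hn3].
    destruct (HMa false false eps Heps) as [n4 Hn4].
    exists (2 + n0 + n1 + n2 + n3 + n4)%nat. split; [lia|]. split.
    - intros x y Hxy. apply Hn0. apply agree_le with (2 := Hxy). lia.
    - intros [|] [|] x y Hxy; [apply Hn1|apply Hn2|apply Hn3|apply Hn4];
        apply agree_le with (2 := Hxy); lia. }
  destruct Hn as [n [Hn2 [Hdn HMn]]]. destruct Hd as [Hdm Hdt].
  exists (glue d (model u v w) n).
  assert (Hmet : Met (glue d (model u v w) n)) by now apply Met_glue with eps.
  split; [exact Hmet|]. split; [split; [exact Hmet|]|].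
  - split; [|split].
    + split.
      * intros ->. apply doubling_glue with eps; auto.
        (* With [u] true the slow scale does not occur, and the other three models are doubling. The
           other two properties are treated alike. *)
        apply (model_ind (fun m => doubling_on m (fun _ => True))); try easy; intros.
        -- apply doubling_on_t3.
        -- now apply doubling_on_real_metric.
        -- apply doubling_on_ultra; [exact Hsf|apply fast_scale_third].
      * intros H. destruct u; [reflexivity|]. exfalso. revert H.
        now apply not_doubling_glue with eps true false.
    + split.
      * intros ->. apply unif_disconnected_glue with eps; auto.
        apply (model_ind (fun m => forall x y z, m x z <= Rmax (m x y) (m y z)));
          try easy; intros; now apply ultra_max.
      * intros H. destruct v; [reflexivity|]. exfalso. revert H.
        now apply not_unif_disconnected_glue with eps false true.
    + split.
      * intros ->. apply unif_perfect_glue with eps; auto.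
        apply model_ind; try easy; intros.
        -- apply perfect_scale_t3.
        -- apply perfect_scale_slow.
        -- apply perfect_scale_thin_gaps.
      * intros H. destruct w; [reflexivity|]. exfalso. revert H.
        now apply not_unif_perfect_glue with eps true true.
  - apply DGamma_lt_iff. exists (4 * eps). split; [unfold eps; lra|].
    intros x y. now apply glue_close.
Qed.

(** Each coordinate contributes to one side only: a required property to the F_sigma part, a
    forbidden one to the G_delta part, with a trivial condition on the other side. *)
Lemma Etype_Fsigma_Gdelta (u v w : bool) : exists A B, met_Fsigma A /\ met_Gdelta B /\
  forall d, Met d -> (Etype u v w d <-> A d /\ B d).
Proof.
  assert (H : forall (b : bool) (Q : metricfun -> Prop), met_Fsigma Q ->
    met_Fsigma (fun d => b = true -> Q d) /\ met_Gdelta (fun d => b = false -> ~ Q d)).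
  { intros [|] Q HQ; split.
    - apply met_Fsigma_ext with Q; [intuition|exact HQ].
    - apply met_Gdelta_ext with (fun _ => True); [intuition congruence|].
      apply met_Gdelta_true.
    - apply met_Fsigma_ext with (fun _ => True); [intuition congruence|].
      apply met_Fsigma_true.
    - apply met_Gdelta_ext with (fun d => ~ Q d); [intuition|now apply met_Gdelta_not]. }
  destruct (H u _ Fsigma_doubling) as [F1 G1].
  destruct (H v _ Fsigma_unif_disconnected) as [F2 G2].
  destruct (H w _ Fsigma_unif_perfect) as [F3 G3].
  do 2 eexists. split; [exact (met_Fsigma_and _ _ F1 (met_Fsigma_and _ _ F2 F3))|].
  split; [exact (met_Gdelta_and _ _ G1 (met_Gdelta_and _ _ G2 G3))|].
  intros d Hd. unfold Etype, of_type. simpl.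
  destruct u, v, w; intuition congruence.
Qed.

Theorem theorem1p8 :
  (met_dense (Etype true true true) /\ met_Fsigma (Etype true true true)) /\
  (met_dense (Etype false false false) /\ met_Gdelta (Etype false false false)) /\
  (forall u v w : bool,
     (u, v, w) <> (true, true, true) -> (u, v, w) <> (false, false, false) ->
     met_dense (Etype u v w) /\ met_Gdeltasigma (Etype u v w) /\
     met_Fsigmadelta (Etype u v w)).
Proof.
  repeat split; try apply met_dense_Etype.
  - apply met_Fsigma_ext with
      (fun d => doubling d /\ unif_disconnected d /\ unif_perfect d).
    + intros d Hd. unfold Etype, of_type. intuition.
    + apply met_Fsigma_and; [apply Fsigma_doubling|].
      apply met_Fsigma_and; [apply Fsigma_unif_disconnected|apply Fsigma_unif_perfect].
  - apply met_Gdelta_ext with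
      (fun d => ~ doubling d /\ ~ unif_disconnected d /\ ~ unif_perfect d).
    + intros d Hd. unfold Etype, of_type. intuition congruence.
    + apply met_Gdelta_and; [apply met_Gdelta_not, Fsigma_doubling|].
      apply met_Gdelta_and; apply met_Gdelta_not;
        [apply Fsigma_unif_disconnected|apply Fsigma_unif_perfect].
  - destruct (Etype_Fsigma_Gdelta u v w) as [A [B [HA [HB E]]]].
    destruct (met_Fsigma_and_Gdelta_Gdeltasigma A B HA HB) as [G [HG HE]].
    exists G. split; [exact HG|]. intros d Hd. now rewrite (E d Hd), (HE d Hd).
  - destruct (Etype_Fsigma_Gdelta u v w) as [A [B [HA [HB E]]]].
    destruct (met_Fsigma_and_Gdelta_Fsigmadelta A B HA HB) as [G [HG HE]].
    exists G. split; [exact HG|]. intros d Hd. now rewrite (E d Hd), (HE d Hd).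
Qed.
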